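(* Let $0<r\le1$, let $\psi\in\mathcal{A}_0$, and let $X$ be an r.i. space on $(0,1)$ satisfying an $\alpha$-lower estimate for some $\alpha>1$. Assume that $$\left\|\frac{\psi(s)^r}{s}\chi_{(0,1)}(s)\right\|_{(X^{(1/r)})'}=\infty$$ and that the function $M(t):=\sup_{t<s<1}\frac{\psi(s)}{\varphi_X(s)}$, $0<t<1$, satisfies $\underline{\beta}_M=\overline{\beta}_M=0$. Let $\mathcal{H}_{\alpha,r,M}:=\{f\in L^0:\|f\|_{\mathcal{H}_{\alpha,r,M}}<\infty\}$, where $$\|f\|_{\mathcal{H}_{\alpha,r,M}}:=\left(\int_0^1\left(\frac{f^{**}(t)}{(\log(e/t))^{1/r}M(t)}\right)^\alpha\frac{dt}{t}\right)^{1/\alpha}.$$ Then there exists a constant $C>0$ such that, for every measurable $f\in L^0(0,1)$, $$\|f\|_{\mathcal{H}_{\alpha,r,M}}\le C\left(\left\|\frac{O(|f|^r,\cdot)^{1/r}}{\psi(\cdot)}\right\|_X+\|f\|_{L^r}\right).$$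
   Context: All function spaces are over $(0,1)$ with Lebesgue measure; $L^0=L^0(0,1)$ is the space of a.e. finite measurable functions. The decreasing rearrangement of $f$ is $f^*(s)=\inf\{t>0:|\{x\in(0,1):|f(x)|>t\}|\le s\}$, and $f^{**}(t)=\frac1t\int_0^t f^*(s)\,ds$ for $0<t<1$. For $0<r\le1$, $O(|f|^r,t):=(|f|^r)^{**}(t)-(|f|^r)^*(t)$. Also $\|f\|_{L^r}=(\int_0^1|f|^r)^{1/r}$. An r.i. space $X$ is a Banach function space on $(0,1)$ (in the sense of Bennett--Sharpley) such that $\|f\|_X=\|g\|_X$ whenever $f^*=g^*$; norms are $+\infty$ for functions not in the space. The fundamental function is $\varphi_X(t)=\|\chi_{(0,t)}\|_X$. The associate space $X'$ has norm $\|g\|_{X'}=\sup_{\|f\|_X\le1}\int_0^1|f(s)g(s)|\,ds$. For $p>0$ the $p$-convexification is $X^{(p)}=\{f:|f|^p\in X\}$, $\|f\|_{X^{(p)}}=\||f|^p\|_X^{1/p}$. $X$ satisfies an $\alpha$-lower estimate if there is a constant $C_\alpha>0$ such that for every finite family $\{f_i\}_{i=1}^n$ of functions with pairwise disjoint supports, $(\sum_i\|f_i\|_X^\alpha)^{1/\alpha}\le C_\alpha\|(\sum_i|f_i|^\alpha)^{1/\alpha}\|_X$. Fundamental indices: for a positive function $\psi$ on $(0,1)$ put $m_\psi(t)=\sup\{\psi(st)/\psi(s):0<s<1,\ st<1\}$, $t>0$. If $m_\psi(t)<\infty$ for all $t>0$, set $\underline{\beta}_\psi=\lim_{t\to0^+}\frac{\log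 m_\psi(t)}{\log t}$ and $\overline{\beta}_\psi=\lim_{t\to\infty}\frac{\log m_\psi(t)}{\log t}$ (and likewise for $M$ in place of $\psi$). $\mathcal{A}_0$ is the class of increasing positive functions $\psi:(0,1)\to(0,\infty)$ with $m_\psi<\infty$, $\psi(0^+)=0$ and $0<\underline{\beta}_\psi\le\overline{\beta}_\psi<1$. *)

(* Defs.v *)
From HB Require Import structures.
From mathcomp Require Import all_boot all_order all_algebra.
From mathcomp Require Import all_classical all_reals all_analysis measurable_realfun.

Set Implicit Arguments.
Unset Strict Implicit.
Unset Printing Implicit Defensive.

Import Order.TTheory GRing.Theory Num.Theory.
Import numFieldNormedType.Exports.

Local Open Scope classical_set_scope.
Local Open Scope ring_scope.

(* Functions on (0,1) are encoded as total functions [R -> \bar R] of which only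
   the values on [I01] matter; measurability is Borel measurability, so that
   every a.e.-class of Lebesgue measurable functions has a representative. *)
Definition I01 {R : realType} : set R := `]0, 1[%classic.

Notation leb := lebesgue_measure.

Section FunctionsOnI01.
Context {R : realType}.
Implicit Types (f g : R -> \bar R) (psi : R -> R) (r s t p alpha : R).
Implicit Types (rho : (R -> \bar R) -> \bar R).
Local Open Scope ereal_scope.

Definition L0 f : Prop :=
  measurable_fun I01 f /\ {ae leb, forall x : R, I01 x -> f x \is a fin_num}.

Definition rearr f s : \bar R :=
  ereal_inf [set t%:E | t in [set t : R | (0 < t)%R /\
    leb (I01 `&` [set x : R | t%:E < `|f x|]) <= s%:E]].

Definition maximal f t : \bar R :=
  (t^-1)%:E * \int[leb]_(s in `]0%R, t[) rearr f s.

(* [osc f r t] is O(|f|^r, t). *)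
Definition osc f r t : \bar R :=
  let fr := fun x => `|f x| `^ r in maximal fr t - rearr fr t.

Definition Lr_norm r f : \bar R :=
  (\int[leb]_(x in I01) (`|f x| `^ r)) `^ r^-1.

Definition Mplus f : Prop :=
  measurable_fun I01 f /\ (forall x : R, I01 x -> 0 <= f x).

(* A Bennett-Sharpley function norm, acting on the cone [Mplus] of measurable
   functions with values in [0, +oo]; its values off [Mplus] are irrelevant. *)
Record function_norm rho : Prop := FunctionNorm {
  fnorm_ge0 : forall f, Mplus f -> 0 <= rho f ;
  fnorm_eq0 : forall f, Mplus f ->
    (rho f = 0 <-> {ae leb, forall x : R, I01 x -> f x = 0}) ;
  fnormZ : forall (a : R) f, (0 <= a)%R -> Mplus f ->
    rho (fun x => a%:E * f x) = a%:E * rho f ;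
  fnorm_triangle : forall f g, Mplus f -> Mplus g ->
    rho (fun x => f x + g x) <= rho f + rho g ;
  fnorm_mono : forall f g, Mplus f -> Mplus g ->
    {ae leb, forall x : R, I01 x -> g x <= f x} -> rho g <= rho f ;
  fnorm_fatou : forall (u : nat -> R -> \bar R) f,
    (forall n, Mplus (u n)) -> Mplus f ->
    {ae leb, forall x : R, I01 x ->
      nondecreasing_seq (u ^~ x) /\ u n x @[n --> \oo] --> f x} ->
    rho (u n) @[n --> \oo] --> rho f ;
  fnorm_indic : forall E : set R, measurable E -> E `<=` I01 ->
    rho (fun x => (\1_E x)%:E) < +oo ;
  fnorm_int : forall E : set R, measurable E -> E `<=` I01 ->
    exists C : R, (0 < C)%R /\
      forall f, Mplus f -> \int[leb]_(x in E) f x <= C%:E * rho f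
}.

Definition rearrangement_invariant rho : Prop :=
  forall f g, Mplus f -> Mplus g ->
    (forall s, (0 < s < 1)%R -> rearr f s = rearr g s) -> rho f = rho g.

(* Convexification and associate norm act on (semi)norms [N] of arbitrary
   measurable functions, such as [ri_norm X] below. *)
Definition convexification p (N : (R -> \bar R) -> \bar R) f : \bar R :=
  (N (fun x => `|f x| `^ p)) `^ p^-1.

Definition assoc_norm (N : (R -> \bar R) -> \bar R) g : \bar R :=
  ereal_sup [set \int[leb]_(s in I01) `|f s * g s| |
             f in [set f | measurable_fun I01 f /\ N f <= 1]].

End FunctionsOnI01.

Record ri_space (R : realType) := RISpace {
  ri_fnorm : (R -> \bar R) -> \bar R ;
  ri_function_norm : function_norm ri_fnorm ;
  ri_invariant : rearrangement_invariant ri_fnorm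
}.

Section RISpaces.
Context {R : realType}.
Implicit Types (X : ri_space R) (f : R -> \bar R) (psi : R -> R).
Implicit Types (r s t alpha : R).

Definition ri_norm X f : \bar R := ri_fnorm X (fun x => `|f x|%E).

(* [fine] loses nothing: the norm of an indicator function is finite. *)
Definition fundamental X t : R :=
  fine (ri_norm X (fun x => (\1_(`]0, t[%classic : set R) x)%:E)).

Definition lower_estimate X alpha : Prop :=
  exists C : R, 0 < C /\
    forall (n : nat) (f : 'I_n -> R -> \bar R),
      (forall i, measurable_fun I01 (f i)) ->
      trivIset [set: 'I_n] (fun i => I01 `&` [set x | f i x != 0%E]) ->
      ((\sum_(i < n) ri_norm X (f i) `^ alpha) `^ alpha^-1 <=
       C%:E * ri_norm X (fun x => (\sum_(i < n) `|f i x| `^ alpha) `^ alpha^-1))%E.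

Definition dilation psi t : \bar R :=
  ereal_sup [set (psi (s * t) / psi s)%:E |
             s in [set s : R | 0 < s < 1 /\ s * t < 1]].

Definition dilation_finite psi : Prop :=
  forall t, 0 < t -> (dilation psi t < +oo)%E.

(* The indices are limits that have to exist, hence relations rather than
   values of the total operator [lim]. *)
Definition lower_index psi (b : R) : Prop :=
  dilation_finite psi /\
  ln (fine (dilation psi t)) / ln t @[t --> 0^'+] --> b.

Definition upper_index psi (b : R) : Prop :=
  dilation_finite psi /\
  ln (fine (dilation psi t)) / ln t @[t --> +oo] --> b.

Definition classA0 psi : Prop :=
  [/\ forall t, 0 < t < 1 -> 0 < psi t,
      forall s t, 0 < s -> s <= t -> t < 1 -> psi s <= psi t,
      dilation_finite psi,
      psi t @[t --> 0^'+] --> (0 : R) &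
      exists bl bu : R, [/\ lower_index psi bl, upper_index psi bu,
                            0 < bl, bl <= bu & bu < 1]].

(* The set is bounded when [psi] is in [classA0]: [psi] is then bounded on (0,1)
   and [fundamental X] is positive and nondecreasing. *)
Definition Mfun psi X t : R :=
  sup [set psi s / fundamental X s | s in `]t, 1[%classic].

Definition H_norm alpha r (M : R -> R) f : \bar R :=
  ((\int[leb]_(t in I01)
     ((maximal f t * ((ln (expR 1 / t) `^ r^-1 * M t)^-1)%:E) `^ alpha
      * (t^-1)%:E)) `^ alpha^-1)%E.

End RISpaces.

(* Main.v *)
Require Import Defs.
From HB Require Import structures.
From mathcomp Require Import all_boot all_order all_algebra.
From mathcomp Require Import all_classical all_reals all_analysis measurable_realfun.
From mathcomp Require Import ring lra.
Import Order.TTheory GRing.Theory Num.Theory.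
Import numFieldNormedType.Exports.
Local Open Scope classical_set_scope.
Local Open Scope ring_scope.

(** Write g = |f|^r, p = alpha / r > 1, and let V(t) = ln(e/t)^(1/r) M(t) be the
    weight of the space on the left-hand side. Everything is sampled at the
    points t_k = l^(k+1), where l is a fixed scale in ]0, 1/2].

    Two elementary facts link g** to the oscillation O = g** - g*: it grows by
    at most a multiple of O(t) when t is replaced by l t
    ([maximal_step]), and t O(t) is nondecreasing ([mul_osc_nondecreasing]). By
    the second one, O^(1/r)/psi dominates a step function with values comparable
    to O(t_k)^(1/r)/psi(t_k) on disjoint intervals of length t_k, so the lower
    alpha-estimate bounds the l^alpha-norm of
    O(t_k)^(1/r) phi_X(t_k)/psi(t_k), hence that of O(t_k)^(1/r)/M(t_k), by the
    X-norm of O^(1/r)/psi ([oscillation_sum]). By the first one,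
    g**(t_k) is at most g**(t_0) plus a multiple of the sum of the earlier
    O(t_i). As ln(e/t_k) is at least a multiple of k + 1 and M is nonincreasing,
    Hardy's inequality for series with exponent p ([hardy_recursion]) turns this
    into a bound for the sum of (g**(t_k)^(1/r)/V(t_k))^alpha, in which the
    starting value g**(t_0) is controlled by the L^r-norm of f.

    It remains to go from h, the 1/r-th power of g**, to f**, which for r < 1 is
    the larger of the two. Since f* <= h, a Hardy inequality for the averaging
    operator is needed, with the weight V^(-alpha). This is where the
    lower index 0 of M enters: M, and therefore V, grows more slowly
    than any power of 1/t, so the scale l can be chosen such that l V(l t)^alpha
    is at most half of V(t)^alpha ([lower_index0_scale], [log_weight_dilation]).
    As f**(t) <= (1 - l) f*(l t) + l f**(l t), passing from t_k to t_(k+1)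
    is then a contraction of the weighted sums, and they can be absorbed
    ([weighted_sum_contraction], [maximal_weighted_sum]). *)

(** * Inequalities for real sequences *)

Section Sequences.
Context {R : realType}.
Implicit Types (p : R) (a w y z : nat -> R).

Lemma inv_half_le (l a b : R) : 0 < a -> 0 < b ->
  l * b <= a / 2 -> l * a^-1 <= b^-1 / 2.
Proof.
move=> a0 b0 h; rewrite ler_pdivrMr// -mulrA mulrC ler_pdivlMr//.
by rewrite (mulrC _ a).
Qed.

Lemma powRN_le (r x y : R) : 0 <= r -> 0 < x -> x <= y ->
  y `^ (- r) <= x `^ (- r).
Proof.
move=> r0 x0 xy; have y0 := lt_le_trans x0 xy.
rewrite !powRN lef_pV2 ?posrE ?powR_gt0//.
by apply: ge0_ler_powR; rewrite ?nnegrE ?(ltW x0) ?(ltW y0).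
Qed.

Lemma le_root_powR (p x y : R) : 0 < p -> 0 <= x -> x `^ p <= y -> x <= y `^ p^-1.
Proof.
move=> p0 x0 xy; have y0 : 0 <= y by apply: le_trans xy; exact: powR_ge0.
have <- : x `^ p `^ p^-1 = x by rewrite -powRrM mulfV ?gt_eqF// powRr1.
by apply: ge0_ler_powR => //; rewrite ?nnegrE ?powR_ge0// invr_ge0 ltW.
Qed.

(** Young's inequality for the conjugate exponents p / (p - 1) and p, with the
    denominators cleared so that the proofs below stay polynomial. *)
Lemma young_cross p (a b : R) : 1 < p -> 0 <= a -> 0 <= b ->
  p * (a `^ (p - 1) * b) <= (p - 1) * a `^ p + b `^ p.
Proof.
move=> p1 a0 b0.
have p0 : 0 < p by exact: lt_trans p1.
have q0 : 0 < p - 1 by rewrite subr_gt0.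
have pq : (p / (p - 1))^-1 + p^-1 = 1 by rewrite invf_div; field; rewrite gt_eqF.
have := conjugate_powR (powR_ge0 a (p - 1)) b0 (divr_gt0 p0 q0) p0 pq.
have e : (p - 1) * (p / (p - 1)) = p by field; rewrite gt_eqF.
rewrite -powRrM e -(ler_pM2l p0) => /le_trans; apply.
by rewrite le_eqVlt; apply/orP; left; apply/eqP; field; rewrite !gt_eqF.
Qed.

(** One step of Elliott's proof of Hardy's inequality: u and v are the means of
    the first N + 1 and the first N terms, and y is the last term. Young's
    inequality is applied to the products with v and with 2 y; the factor 2
    leaves the multiple (p - 1) / 2 of u^p on the left. *)
Lemma hardy_step p (N u v y : R) : 1 < p -> 0 <= N -> 0 <= u -> 0 <= v ->
  0 <= y -> (N + 1) * u = N * v + y ->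
  (p - 1) / 2 * u `^ p + (N + 1) * u `^ p <= N * v `^ p + 2^-1 * (2 * y) `^ p.
Proof.
move=> p1 N0 u0 v0 y0 e.
have p0 : 0 < p by exact: lt_trans p1.
have h1 := young_cross p u v p1 u0 v0.
have h2 := young_cross p u (2 * y) p1 u0 (mulr_ge0 (ler0n _ 2) y0).
have e2 : u `^ (p - 1) * u = u `^ p by rewrite mulrC mulr_powRB1.
have h3 : p * ((N + 1) * u `^ p) =
    N * (p * (u `^ (p - 1) * v)) + 2^-1 * (p * (u `^ (p - 1) * (2 * y))).
  rewrite -e2; transitivity (p * u `^ (p - 1) * ((N + 1) * u)); first by ring.
  by rewrite e; field.
have := ler_wpM2l N0 h1.
move: h2 h3; nra.
Qed.

(** Hardy's inequality for series: [hardy_step] telescopes. The term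
    n A_n^p in the strengthened statement is what the telescoping leaves over. *)
Lemma discrete_hardy p y (n : nat) : 1 < p -> (forall k, 0 <= y k) ->
  \sum_(k < n) ((\sum_(i < k.+1) y i) / k.+1%:R) `^ p <=
  2 `^ p / (p - 1) * \sum_(k < n) y k `^ p.
Proof.
move=> p1 y0; pose A k := (\sum_(i < k) y i) / k%:R.
have A0 k : 0 <= A k by rewrite divr_ge0// sumr_ge0.
have q0 : 0 < p - 1 by rewrite subr_gt0.
suff : (p - 1) / 2 * \sum_(k < n) A k.+1 `^ p + n%:R * A n `^ p <=
       2^-1 * 2 `^ p * \sum_(k < n) y k `^ p.
  move=> h; rewrite mulrAC ler_pdivlMr//.
  have : 0 <= n%:R * A n `^ p by rewrite mulr_ge0 ?powR_ge0.
  move: h; set S1 := \sum_(k < n) A k.+1 `^ p; set S2 := \sum_(k < n) y k `^ p.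
  rewrite -/S1; lra.
elim: n => [|n ih]; first by rewrite !big_ord0 mul0r !mulr0 addr0.
rewrite !big_ord_recr/= !mulrDr.
have e : (n%:R + 1) * A n.+1 = n%:R * A n + y n.
  rewrite natr1 /A mulrC divfK ?pnatr_eq0// big_ord_recr/=; congr (_ + _).
  case: n {ih} => [|n]; first by rewrite mul0r big_ord0.
  by rewrite mulrC divfK ?pnatr_eq0.
have := hardy_step p n%:R (A n.+1) (A n) (y n) p1 (ler0n _ _) (A0 _) (A0 _) (y0 _) e.
rewrite powRM// (natr1 n); lra.
Qed.

Lemma convex_comb_powR p (t a b : R) : 1 <= p -> 0 <= t <= 1 -> 0 <= a -> 0 <= b ->
  (t * a + (1 - t) * b) `^ p <= t * a `^ p + (1 - t) * b `^ p.
Proof.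
move=> p1 /andP[t0 t1] a0 b0.
have := convex_powR p1 (Itv01 t0 t1) (_ : a \in _) (_ : b \in _).
by rewrite !inE/= !in_itv/= !andbT => /(_ a0 b0).
Qed.

(** By convexity of the power, replacing a_k by a_(k+1) on the right costs the
    factor l w_k / w_(k+1) <= 1/2, so the weighted sum of a^p is
    absorbed up to the boundary term at n. *)
Lemma weighted_sum_contraction p (l : R) a w z (n : nat) : 1 <= p -> 0 <= l <= 1 ->
  (forall k, 0 <= a k) -> (forall k, 0 <= w k) -> (forall k, 0 <= z k) ->
  (forall k, l * w k <= w k.+1 / 2) ->
  (forall k, (k < n)%N -> a k <= (1 - l) * z k + l * a k.+1) ->
  \sum_(k < n) w k * a k `^ p <=
  2 * \sum_(k < n) w k * z k `^ p + w n * a n `^ p.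
Proof.
move=> p1 /andP[l0 l1] a0 w0 z0 lw ha.
have step k : (k < n)%N ->
    w k * a k `^ p <= w k * z k `^ p + w k.+1 * a k.+1 `^ p / 2.
  move=> kn; have l1' : 0 <= 1 - l <= 1 by rewrite subr_ge0 l1 gerBl.
  apply: (@le_trans _ _ (w k * ((1 - l) * z k `^ p + l * a k.+1 `^ p))).
    rewrite ler_wpM2l//; apply: le_trans (_ : ((1 - l) * z k + l * a k.+1) `^ p <= _).
      by rewrite ge0_ler_powR ?nnegrE ?ha// ?(le_trans _ p1)//
        addr_ge0// mulr_ge0// subr_ge0.
    have := convex_comb_powR p (1 - l) _ _ p1 l1' (z0 k) (a0 k.+1).
    by rewrite opprB subrKC.
  have h1 := ler_wpM2r (powR_ge0 (a k.+1) p) (lw k).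
  have h2 : 0 <= l * w k * z k `^ p by rewrite !mulr_ge0 ?powR_ge0.
  lra.
have h : \sum_(k < n) w k * a k `^ p <= \sum_(k < n) w k * z k `^ p +
    (\sum_(k < n) w k.+1 * a k.+1 `^ p) / 2.
  by rewrite mulr_suml -big_split/=; apply: ler_sum => i _; exact: step.
have e : w 0%N * a 0%N `^ p + \sum_(k < n) w k.+1 * a k.+1 `^ p =
    \sum_(k < n) w k * a k `^ p + w n * a n `^ p.
  transitivity (\sum_(k < n.+1) w k * a k `^ p); first by rewrite big_ord_recl.
  by rewrite big_ord_recr.
have : 0 <= w 0%N * a 0%N `^ p by rewrite mulr_ge0 ?powR_ge0.
lra.
Qed.

(** Iterating the recursion bounds b_k mu_k by the partial sums of a sequence y
    whose first term carries the starting value b_0 and whose other terms are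
    kappa o_k mu_k; Hardy's inequality applies to y. *)
Lemma hardy_recursion p (kappa : R) (b o mu : nat -> R) (n : nat) :
  1 < p -> 0 <= kappa -> (forall k, 0 <= o k) -> o 0%N <= b 0%N -> (forall k, 0 <= b k) ->
  (forall k, 0 <= mu k) -> (forall k, mu k.+1 <= mu k) ->
  (forall k, b k.+1 <= b k + kappa * o k) ->
  \sum_(k < n) (b k * mu k / k.+1%:R) `^ p <=
  2 `^ p / (p - 1) * (((1 + kappa) * (b 0%N * mu 0%N)) `^ p +
                      kappa `^ p * \sum_(k < n) (o k * mu k) `^ p).
Proof.
move=> p1 k0 o0 ob b0 mu0 mun hb.
have p0 : 0 <= p by rewrite (le_trans _ (ltW p1)).
pose y k := if k is 0%N then (1 + kappa) * (b 0%N * mu 0%N) else kappa * (o k * mu k).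
have y0 k : 0 <= y k by case: k => [|k]; rewrite !mulr_ge0// addr_ge0.
have hy k : b k * mu k + kappa * (o k * mu k) <= \sum_(i < k.+1) y i.
  elim: k => [|k ih].
    rewrite big_ord1/= mulrDl mul1r lerD2l ler_wpM2l// ler_wpM2r//.
  rewrite big_ord_recr/= lerD2r (le_trans _ ih)//.
  apply: (@le_trans _ _ ((b k + kappa * o k) * mu k.+1)); first by rewrite ler_wpM2r.
  rewrite mulrA -mulrDl ler_wpM2l// addr_ge0// mulr_ge0//.
apply: (@le_trans _ _ (\sum_(k < n) ((\sum_(i < k.+1) y i) / k.+1%:R) `^ p)).
  apply: ler_sum => k _; apply: ge0_ler_powR => //; rewrite ?nnegrE.
  - by rewrite divr_ge0// mulr_ge0.
  - by rewrite divr_ge0// sumr_ge0.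
  - rewrite ler_wpM2r ?invr_ge0// (le_trans _ (hy k))// lerDl !mulr_ge0//.
apply: le_trans (discrete_hardy p y n p1 y0) _.
rewrite ler_wpM2l ?divr_ge0 ?powR_ge0 ?subr_ge0 ?(ltW p1)// mulr_sumr.
case: n => [|n]; first by rewrite !big_ord0 addr0 powR_ge0.
rewrite !big_ord_recl/= lerD2l.
have : 0 <= kappa `^ p * (o 0%N * mu 0%N) `^ p by rewrite mulr_ge0 ?powR_ge0.
move=> h; apply: (ler_wpDl h).
by apply: ler_sum => k _; rewrite powRM// mulr_ge0.
Qed.

End Sequences.

(** * Decreasing rearrangement *)

Section Rearrangement.
Context {R : realType}.
Implicit Types (f g h : R -> \bar R) (s t r : R).
Local Open Scope ereal_scope.

Lemma rearr_ge0 f s : 0 <= rearr f s.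
Proof.
by apply: le_ereal_inf_tmp => _ [t [t0 _] <-]; rewrite lee_fin ltW.
Qed.

Lemma rearr_le f s t : (0 < t)%R ->
  leb (I01 `&` [set x : R | t%:E < `|f x|]) <= s%:E -> rearr f s <= t%:E.
Proof. by move=> t0 h; apply: ereal_inf_lbound; exists t. Qed.

Lemma rearr_nonincreasing f : {homo rearr f : s t / (s <= t)%R >-> t <= s}.
Proof.
move=> s t st; apply: ereal_inf_le_tmp => _ [u [u0 h] <-]; exists u => //.
by split=> //; rewrite (le_trans h)// lee_fin.
Qed.

(** The level set of |f| at t^(1/r) is the level set of |f|^r at t. *)
Lemma poweR_rearr_le f r s : (0 < r)%R ->
  rearr f s `^ r <= rearr (fun x => `|f x| `^ r) s.
Proof.
move=> r0; apply: le_ereal_inf_tmp => _ [t [t0 h] <-].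
have t0' : (0 < t `^ r^-1)%R by rewrite powR_gt0.
have e : (t `^ r^-1 `^ r)%R = t by rewrite -powRrM mulVf ?gt_eqF// powRr1// ltW.
have : rearr f s <= (t `^ r^-1)%:E.
  apply: rearr_le => //; apply: le_trans h.
  rewrite le_eqVlt; apply/orP; left; apply/eqP; congr (leb (_ `&` _)).
  apply/seteqP; split=> x /=; rewrite (gee0_abs (poweR_ge0 _ _)).
    rewrite !ltNge; apply: contra => hx.
    have : (`|f x| `^ r) `^ r^-1 <= t%:E `^ r^-1.
      by apply: gt0_ler_poweR; rewrite ?in_itv/= ?leey ?poweR_ge0 ?lee_fin ?invr_ge0// ltW.
    by rewrite -poweRrM mulfV ?gt_eqF// poweRe1.
  rewrite !ltNge; apply: contra => hx.
  have : `|f x| `^ r <= (t `^ r^-1)%:E `^ r.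
    by apply: gt0_ler_poweR; rewrite ?in_itv/= ?leey ?abse_ge0 ?lee_fin ?andbT// ltW.
  by rewrite poweR_EFin e.
move=> hs; have : rearr f s `^ r <= (t `^ r^-1)%:E `^ r.
  by apply: gt0_ler_poweR; rewrite ?in_itv/= ?leey ?rearr_ge0 ?lee_fin ?andbT// ltW.
by rewrite poweR_EFin e.
Qed.

Lemma nonincreasing_emeasurable (D : set R) h : measurable D ->
  {homo h : s t / (s <= t)%R >-> t <= s} -> measurable_fun D h.
Proof.
move=> mD hh; apply: (measurability _ (ErealGenCInfty.measurableE R)) => //.
move=> /= _ [_ [x ->]] <-; apply: measurableI => //.
apply: is_interval_measurable => s t/=.
rewrite !in_itv/= !andbT => xs xt u /andP[su ut].
by rewrite in_itv/= andbT (le_trans xt)// hh.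
Qed.

(** Extending h by +oo to the left of the interval and by -oo to the right of it
    makes it monotone on the whole line. *)
Lemma nonincreasing_measurable_I01 h :
  (forall s t, (0 < s)%R -> (s <= t)%R -> (t < 1)%R -> h t <= h s) -> measurable_fun I01 h.
Proof.
move=> hh; pose g t := if (t <= 0)%R then +oo else if (t < 1)%R then h t else -oo.
apply: (eq_measurable_fun g).
  by move=> t; rewrite inE /I01/= in_itv/= /g leNgt => /andP[-> ->].
apply: nonincreasing_emeasurable; first exact: measurable_itv.
move=> s t st; rewrite /g; case: (leP s 0%R) => s0; first by rewrite leey.
case: (leP t 0%R) => [t0|_]; first by rewrite ltNge (le_trans st t0) in s0.
by case: (ltP t 1%R) => t1; [rewrite (le_lt_trans st t1) hh|rewrite leNye].
Qed.

Lemma measurable_rearr (D : set R) f : measurable D -> measurable_fun D (rearr f).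
Proof. by move=> mD; apply: nonincreasing_emeasurable => //; exact: rearr_nonincreasing. Qed.

Lemma lebesgue_measure_subgraph (a : \bar R) : 0 <= a ->
  leb [set t : R | (0 < t)%R /\ t%:E < a] = a.
Proof.
case: a => [a| |]// a0.
  rewrite (_ : [set _ | _] = `]0%R, a[%classic).
    rewrite lebesgue_measure_itv/= lte_fin; rewrite lee_fin le_eqVlt in a0.
    by case/predU1P: a0 => [<-|->]; rewrite ?ltxx// oppr0 adde0.
  by apply/seteqP; split=> t /=; rewrite in_itv/= lte_fin => /andP.
rewrite (_ : [set _ | _] = `]0%R, +oo[%classic); first by rewrite lebesgue_measure_itv/= ltry.
by apply/seteqP; split=> t /=; rewrite in_itv/= andbT ?ltry// => -[].
Qed.

Lemma lt_rearr f s t : (0 < t)%R -> t%:E < rearr f s ->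
  s%:E < leb (I01 `&` [set x : R | t%:E < `|f x|]).
Proof. by move=> t0; rewrite !ltNge; apply: contra; exact: rearr_le. Qed.

Lemma distribution_nonincreasing h : measurable_fun I01 h ->
  {homo (fun t => leb (I01 `&` [set x : R | t%:E < h x])) :
    s t / (s <= t)%R >-> t <= s}.
Proof.
move=> mh s t st; have mI : measurable (I01 : set R) by exact: measurable_itv.
apply: le_measure; rewrite ?inE; [exact: emeasurable_fun_o_infty..|].
by apply: setIS => x /=; apply: le_lt_trans; rewrite lee_fin.
Qed.

(** Tonelli for the indicator function of the region below the graph of h. *)
Lemma layer_cake h : measurable_fun I01 h -> (forall x : R, I01 x -> 0 <= h x) ->
  \int[leb]_(x in I01) h x =
  \int[leb]_(t in `]0%R, +oo[) leb (I01 `&` [set x : R | t%:E < h x]).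
Proof.
move=> mh h0.
pose A : set (measurableTypeR R * measurableTypeR R) :=
  (I01 `*` `]0%R, +oo[) `&` [set z | z.2%:E < h z.1].
have xA x : leb (xsection A x) = (h \_ I01) x.
  rewrite patchE; case: ifPn => [|xI].
    rewrite inE => xI; rewrite -[RHS](lebesgue_measure_subgraph (h x)) ?h0//.
    congr (leb _); apply/seteqP; split=> t; rewrite xsectionE /A/= !in_itv/= ?andbT.
      by move=> [[]].
    by move=> [].
  rewrite (_ : xsection A x = set0) ?measure0//.
  apply/seteqP; split=> t //; rewrite xsectionE /A => -[[/= xI' _] _].
  by move: xI; rewrite notin_setE.
have yA t : leb (ysection A t) =
    ((fun t => leb (I01 `&` [set x : R | t%:E < h x])) \_ `]0%R, +oo[) t.
  rewrite patchE; case: ifPn => [|tI].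
    rewrite inE => tI; congr (leb _); apply/seteqP; split=> x; rewrite ysectionE /A/=.
      by move=> [[]].
    by move=> [].
  rewrite (_ : ysection A t = set0) ?measure0//.
  apply/seteqP; split=> x //; rewrite ysectionE /A => -[[/= _ tI'] _].
  by move: tI; rewrite notin_setE.
have mA : measurable A.
  have mI : measurable (I01 : set R) by exact: measurable_itv.
  apply: measurable_lte.
  - by apply: measurableX => //; exact: measurable_itv.
  - by apply/measurable_EFinP; apply: measurable_funTS; exact: measurable_snd.
  - apply: (measurable_comp mI _ mh); last by apply: measurable_funTS; exact: measurable_fst.
    by move=> _ [z [/= ? _] <-].
rewrite integral_mkcond [RHS]integral_mkcond -(funext xA) -(funext yA).
have := indic_fubini_tonelli (@lebesgue_measure R) (@lebesgue_measure R) mA.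
by rewrite (indic_fubini_tonelli_FE _ mA) (indic_fubini_tonelli_GE _ mA).
Qed.

(** By the layer cake formula it suffices to compare distribution functions:
    if t < f*(s), then s lies below the measure of the set where |f| > t. *)
Lemma integral_rearr_le f : measurable_fun I01 f ->
  \int[leb]_(s in I01) rearr f s <= \int[leb]_(x in I01) `|f x|.
Proof.
move=> mf; have mI : measurable (I01 : set R) by exact: measurable_itv.
have maf : measurable_fun I01 (fun x => `|f x|) by exact: measurableT_comp.
have mr : measurable_fun I01 (rearr f) by exact: measurable_rearr.
rewrite layer_cake//; last by move=> x _; exact: rearr_ge0.
rewrite [leRHS]layer_cake//.
apply: ge0_le_integral => //=.
- by apply: nonincreasing_emeasurable => //; exact: distribution_nonincreasing.
- by apply: nonincreasing_emeasurable => //; exact: distribution_nonincreasing.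
move=> t; rewrite in_itv/= andbT => t0.
set m := leb (I01 `&` [set x | t%:E < `|f x|]).
have mfin : m \is a fin_num.
  rewrite ge0_fin_numE; last exact: measure_ge0.
  apply: (@le_lt_trans _ _ (leb (I01 : set R))).
    by apply: le_measure; rewrite ?inE//; exact: emeasurable_fun_o_infty.
  by rewrite lebesgue_measure_itv/= lte01 oppr0 adde0 ltry.
rewrite -(fineK mfin).
apply: (@le_trans _ _ (leb (`]0%R, fine m[%classic : set R))).
  apply: le_measure; rewrite ?inE; [exact: emeasurable_fun_o_infty|exact: measurable_itv|].
  move=> s [/=]; rewrite !in_itv/= => /andP[s0 _] /(lt_rearr _ _ _ t0).
  by rewrite -/m -(fineK mfin) lte_fin => ->; rewrite andbT.
rewrite lebesgue_measure_itv/= lte_fin.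
by case: ifPn; rewrite ?oppr0 ?adde0// fineK// measure_ge0.
Qed.

End Rearrangement.

(** * The maximal function f** *)

Section Maximal.
Context {R : realType}.
Implicit Types (f g : R -> \bar R) (a s t u l : R).
Local Open Scope ereal_scope.

Lemma integral_rearr_itv_le f s t : (s <= t)%R ->
  \int[leb]_(x in `[s, t[) rearr f x <= (t - s)%:E * rearr f s.
Proof.
move=> st; apply: (@le_trans _ _ (\int[leb]_(x in `[s, t[) cst (rearr f s) x)).
  apply: ge0_le_integral => //=.
  - by move=> x _; exact: rearr_ge0.
  - exact: measurable_rearr.
  - by move=> x; rewrite in_itv/= => /andP[sx _]; exact: rearr_nonincreasing.
rewrite integral_cst//= lebesgue_measure_itv/= lte_fin muleC; case: ltP => //= ts.
by rewrite mul0e mule_ge0 ?rearr_ge0// lee_fin subr_ge0.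
Qed.

Lemma integral_rearr_itv_ge f s t : (s <= t)%R ->
  (t - s)%:E * rearr f t <= \int[leb]_(x in `[s, t[) rearr f x.
Proof.
move=> st; apply: (@le_trans _ _ (\int[leb]_(x in `[s, t[) cst (rearr f t) x)); last first.
  apply: ge0_le_integral => //=.
  - by move=> x _; exact: rearr_ge0.
  - exact: measurable_rearr.
  - by move=> x; rewrite in_itv/= => /andP[_ /ltW]; exact: rearr_nonincreasing.
rewrite integral_cst//= lebesgue_measure_itv/= lte_fin; case: ltP => /= [_|ts].
  by rewrite muleC.
rewrite mule0 (_ : t = s) ?subrr ?mul0e//; by apply/eqP; rewrite eq_le st ts.
Qed.

Lemma integral_rearr_split f (b : itv_bound R) s t : (b <= BLeft s)%O -> (s <= t)%R ->
  \int[leb]_(x in [set` Interval b (BLeft t)]) rearr f x =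
  \int[leb]_(x in [set` Interval b (BLeft s)]) rearr f x +
  \int[leb]_(x in `[s, t[) rearr f x.
Proof.
move=> bs st; rewrite -ge0_integral_setU//=.
- by congr (integral _ _ _); rewrite (itv_bndbnd_setU bs)// bnd_simp.
- by apply: measurable_rearr; apply: measurableU; exact: measurable_itv.
- by move=> x _; exact: rearr_ge0.
- apply/disj_set2P; apply/seteqP; split=> x //= [].
  rewrite !itv_boundlr/= => /andP[_ h1] /andP[h2 _]; move: h1 h2.
  by rewrite !bnd_simp => /lt_le_trans h /h; rewrite ltxx.
Qed.

Lemma primitiveE f t : (0 < t)%R ->
  \int[leb]_(s in `]0%R, t[) rearr f s = t%:E * maximal f t.
Proof.
by move=> t0; rewrite /maximal muleA -EFinM divff ?gt_eqF// mul1e.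
Qed.

Lemma maximal_ge0 f t : (0 < t)%R -> 0 <= maximal f t.
Proof.
move=> t0; apply: mule_ge0; first by rewrite lee_fin invr_ge0 ltW.
by apply: integral_ge0 => x _; exact: rearr_ge0.
Qed.

(** The additivity of t f**(t) = \int_0^t f* from which all the
    comparisons of f** at two points are derived. *)
Lemma maximal_split f s t : (0 < s)%R -> (s <= t)%R ->
  t%:E * maximal f t = s%:E * maximal f s + \int[leb]_(x in `[s, t[) rearr f x.
Proof.
move=> s0 st; rewrite -!primitiveE// ?(lt_le_trans s0)//.
by rewrite -integral_rearr_split// bnd_simp.
Qed.

Lemma rearr_le_maximal f t : (0 < t)%R -> rearr f t <= maximal f t.
Proof.
move=> t0; rewrite -(@lee_pmul2l _ t%:E) ?lte_fin// -primitiveE//.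
rewrite (@integral_itv_obnd_cbnd _ 0%R (BLeft t)); last exact: measurable_rearr.
by have := integral_rearr_itv_ge f 0 t (ltW t0); rewrite subr0.
Qed.

Lemma maximal_nonincreasing f s t : (0 < s)%R -> (s <= t)%R ->
  maximal f t <= maximal f s.
Proof.
move=> s0 st; have t0 := lt_le_trans s0 st.
rewrite -(@lee_pmul2l _ t%:E) ?lte_fin// (maximal_split f s t)//.
have -> : t%:E * maximal f s = s%:E * maximal f s + (t - s)%:E * maximal f s.
  by rewrite -ge0_muleDl ?lee_fin ?subr_ge0// ?ltW// -EFinD subrKC.
rewrite leeD2l// (le_trans (integral_rearr_itv_le f s t st))//.
by rewrite lee_wpmul2l ?lee_fin ?subr_ge0// rearr_le_maximal.
Qed.

Lemma maximal_dilation f l t : (0 < l <= 1)%R -> (0 < t)%R ->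
  maximal f t <= (1 - l)%:E * rearr f (l * t) + l%:E * maximal f (l * t).
Proof.
move=> /andP[l0 l1] t0; rewrite -(@lee_pmul2l _ t%:E) ?lte_fin//.
have st : (l * t <= t)%R by rewrite ger_pMl.
rewrite (maximal_split f (l * t) t) ?mulr_gt0//.
have lt0 : (0 < l * t)%R by exact: mulr_gt0.
rewrite ge0_muleDr; last 2 first.
- by rewrite mule_ge0 ?rearr_ge0// lee_fin subr_ge0.
- by rewrite mule_ge0 ?maximal_ge0// lee_fin ltW.
rewrite addeC !muleA -!EFinM (mulrC t l) leeD2r//.
by rewrite (le_trans (integral_rearr_itv_le f _ t st))// mulrBr mulr1 (mulrC t l).
Qed.

(** Bounds for the integrals of f* away from 0, which are finite for trivial
    reasons, pass to the full integral by monotone convergence. *)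
Lemma integral_rearr_le_sup f (u : nat -> R) t (B : \bar R) :
  nonincreasing_seq u -> u n @[n --> \oo] --> 0%R -> (forall n, 0 < u n)%R ->
  (forall n, \int[leb]_(x in `[u n, t[) rearr f x <= B) ->
  \int[leb]_(x in `]0%R, t[) rearr f x <= B.
Proof.
move=> un u0 u_gt0 hB.
have : \int[leb]_(x in `[u n, t[) rearr f x @[n --> \oo] -->
    \int[leb]_(x in \bigcup_n `[u n, t[%classic) rearr f x.
  apply: ge0_nondecreasing_set_cvg_integral => //.
  - move=> m n mn; apply/subsetPset => x/=; rewrite !in_itv/= => /andP[h ->].
    by rewrite (le_trans _ h)// un.
  - by move=> n; exact: measurable_rearr.
  - by move=> n x _; exact: rearr_ge0.
rewrite (_ : \bigcup_n _ = `]0%R, t[%classic).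
  move=> /cvg_lim <- //; apply: lime_le; last exact: nearW.
  apply: ereal_nondecreasing_is_cvgn.
  apply: ge0_nondecreasing_set_nondecreasing_integral => //.
  - move=> m n mn; apply/subsetPset => x/=; rewrite !in_itv/= => /andP[h ->].
    by rewrite (le_trans _ h)// un.
  - by move=> n; exact: measurable_rearr.
  - by move=> n x _; exact: rearr_ge0.
apply/seteqP; split=> [x [n _ /=]|x /=]; rewrite !in_itv/=.
  by move=> /andP[h ->]; rewrite (lt_le_trans _ h).
move=> /andP[x0 xt]; have /cvgr_le := u0.
move=> /(_ _ x0)[n _ /(_ n (leqnn n)) h].
by exists n => //=; rewrite in_itv/= h.
Qed.

End Maximal.

(** * The oscillation f** - f* *)

Section Oscillation.
Context {R : realType}.
Implicit Types (f g : R -> \bar R) (a s t u l : R).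

Lemma measurable_maximal f : measurable_fun I01 (maximal f).
Proof.
by apply: nonincreasing_measurable_I01 => s t s0 st _; exact: maximal_nonincreasing.
Qed.

(** When k* is integrable, k** and k* are finite on ]0, 1], and the comparisons
    can be made between real numbers. *)
Section finite_integral.
Variable k : R -> \bar R.
Hypothesis kfin : (\int[leb]_(s in I01) rearr k s < +oo)%E.

Lemma maximal_fin_num t : 0 < t <= 1 -> maximal k t \is a fin_num.
Proof.
move=> /andP[t0 t1]; rewrite ge0_fin_numE ?maximal_ge0//.
rewrite /maximal; apply: lte_mul_pinfty => //; first by rewrite lee_fin invr_ge0 ltW.
apply: le_lt_trans kfin; apply: ge0_subset_integral => //.
- exact: measurable_itv.
- by apply: measurable_rearr; exact: measurable_itv.
- by move=> x _; exact: rearr_ge0.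
- by move=> x; rewrite /I01/= !in_itv/= => /andP[x0 xt]; rewrite x0 (lt_le_trans xt).
Qed.

Lemma rearr_fin_num t : 0 < t <= 1 -> rearr k t \is a fin_num.
Proof.
move=> t01; have /andP[t0 _] := t01.
rewrite ge0_fin_numE ?rearr_ge0// (le_lt_trans (rearr_le_maximal k t t0))//.
by rewrite -ge0_fin_numE ?maximal_ge0// maximal_fin_num.
Qed.

Let m t := fine (maximal k t).
Let h t := fine (rearr k t).

Lemma maximal_split_ge s t : 0 < s -> s <= t -> t <= 1 ->
  s * m s + (t - s) * h t <= t * m t.
Proof.
move=> s0 st t1; have t0 := lt_le_trans s0 st.
have t01 : 0 < t <= 1 by rewrite t0.
have s01 : 0 < s <= 1 by rewrite s0 (le_trans st).
rewrite -lee_fin EFinD !EFinM /m /h !fineK ?maximal_fin_num ?rearr_fin_num//.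
by rewrite (maximal_split k s t)// leeD2l// integral_rearr_itv_ge.
Qed.

Lemma fine_oscE t : 0 < t <= 1 -> fine (maximal k t - rearr k t)%E = m t - h t.
Proof. by move=> t01; rewrite fineB// ?maximal_fin_num ?rearr_fin_num. Qed.

(** The average of k* over ]0, t[ is a convex combination of the averages over
    ]0, l t[ and over [l t, t[, and the latter is at least k*(t). *)
Lemma maximal_step l t : 0 < l <= 1 -> 0 < t <= 1 ->
  m (l * t) <= m t + (l^-1 - 1) * fine (maximal k t - rearr k t)%E.
Proof.
move=> /andP[l0 l1] t01; have /andP[t0 t1] := t01.
have e : l * (m t + (l^-1 - 1) * (m t - h t)) = m t - (1 - l) * h t.
  by field; rewrite gt_eqF.
have lt1 : l * t <= t by rewrite ger_pMl.
have := maximal_split_ge (l * t) t (mulr_gt0 l0 t0) lt1 t1.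
move=> hh; rewrite fine_oscE// -(ler_pM2l l0) e -(ler_pM2l t0) mulrBr lerBrDr.
by apply: le_trans hh; rewrite le_eqVlt; apply/orP; left; apply/eqP; ring.
Qed.

Lemma osc_ge0 t : 0 < t <= 1 -> 0 <= fine (maximal k t - rearr k t)%E.
Proof.
move=> t01; have /andP[t0 _] := t01; rewrite fine_oscE// subr_ge0.
by rewrite fine_le ?rearr_fin_num ?maximal_fin_num ?rearr_le_maximal.
Qed.

(** t (k**(t) - k*(t)) is the integral over ]0, t[ of k* - k*(t), and both the
    domain and the integrand increase with t. *)
Lemma mul_osc_nondecreasing s t : 0 < s -> s <= t -> t <= 1 ->
  s * fine (maximal k s - rearr k s)%E <= t * fine (maximal k t - rearr k t)%E.
Proof.
move=> s0 st t1; have t0 := lt_le_trans s0 st.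
have t01 : 0 < t <= 1 by rewrite t0.
have s01 : 0 < s <= 1 by rewrite s0 (le_trans st).
have := maximal_split_ge s t s0 st t1.
have : h t <= h s by rewrite fine_le ?rearr_fin_num ?rearr_nonincreasing.
rewrite !fine_oscE//; nra.
Qed.

End finite_integral.

Lemma measurable_osc f r : measurable_fun I01 (osc f r).
Proof.
apply: emeasurable_funB; first exact: measurable_maximal.
by apply: measurable_rearr; exact: measurable_itv.
Qed.

End Oscillation.

(** * Norms of indicator functions and the lower estimate *)

Section Spaces.
Context {R : realType}.
Implicit Types (X : ri_space R) (f g F : R -> \bar R) (psi : R -> R) (E : set R).
Implicit Types (s t u alpha : R).

Lemma Mplus_abse f : measurable_fun I01 f -> Mplus (fun x => `|f x|%E).
Proof. by move=> mf; split=> [|x _]; [exact: measurableT_comp|exact: abse_ge0]. Qed.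

Lemma Mplus_indic E : measurable E -> Mplus (fun x => (\1_E x)%:E).
Proof.
move=> mE; split=> [|x _]; last by rewrite lee_fin.
by apply/measurable_EFinP; exact: measurable_indic.
Qed.

Lemma ri_norm_indicE X E :
  ri_norm X (fun x => (\1_E x)%:E) = ri_fnorm X (fun x => (\1_E x)%:E).
Proof. by congr (ri_fnorm X _); apply/funext => x; rewrite gee0_abs// lee_fin. Qed.

Lemma distribution_indic E u : E `<=` I01 -> 0 < u ->
  I01 `&` [set x | (u%:E < `|(\1_E x)%:E|)%E] = if u < 1 then E else set0.
Proof.
move=> EI u0; apply/seteqP; split=> x /=.
  rewrite lte_fin indicE => -[_]; case: (boolP (x \in E)) => xE /=.
    by rewrite normr1 => ->; rewrite -in_setE.
  by rewrite normr0 ltNge ltW.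
case: ifPn => // u1 Ex; split; first exact: EI.
by rewrite lte_fin indicE mem_set// normr1.
Qed.

Lemma ri_norm_indic_eq X E E' : measurable E -> measurable E' ->
  E `<=` I01 -> E' `<=` I01 -> leb E = leb E' ->
  ri_norm X (fun x => (\1_E x)%:E) = ri_norm X (fun x => (\1_E' x)%:E).
Proof.
move=> mE mE' EI EI' e; rewrite !ri_norm_indicE.
apply: (ri_invariant X); [exact: Mplus_indic..|] => s _.
congr ereal_inf; apply/seteqP; split=> _ [u [u0 h] <-]; exists u => //; split=> //;
  by move: h; rewrite !distribution_indic//; case: ifPn => // _; rewrite e.
Qed.

Lemma ri_norm_indic_le X E E' : measurable E -> measurable E' -> E `<=` E' ->
  (ri_norm X (fun x => (\1_E x)%:E) <= ri_norm X (fun x => (\1_E' x)%:E))%E.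
Proof.
move=> mE mE' EE; rewrite !ri_norm_indicE.
apply: (fnorm_mono (ri_function_norm X)); [exact: Mplus_indic..|].
apply: aeW => x _; rewrite lee_fin !indicE.
by case: (boolP (x \in E)) => //; rewrite inE => /EE xE; rewrite mem_set.
Qed.

Lemma subset_I01 t : 0 < t <= 1 -> `]0, t[%classic `<=` (I01 : set R).
Proof.
move=> /andP[t0 t1] x /=; rewrite /I01/= !in_itv/= => /andP[-> /lt_le_trans]; exact.
Qed.

Lemma fundamentalE X t : 0 < t <= 1 ->
  ri_norm X (fun x => (\1_(`]0, t[%classic : set R) x)%:E) = (fundamental X t)%:E.
Proof.
move=> t01; rewrite /fundamental fineK// ri_norm_indicE ge0_fin_numE.
  apply: (fnorm_indic (ri_function_norm X)); first exact: measurable_itv.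
  exact: subset_I01.
by apply: (fnorm_ge0 (ri_function_norm X)); apply: Mplus_indic; exact: measurable_itv.
Qed.

Lemma fundamental_nondecreasing X s t : 0 < s -> s <= t -> t <= 1 ->
  fundamental X s <= fundamental X t.
Proof.
move=> s0 st t1; rewrite -lee_fin -!fundamentalE ?s0 ?(lt_le_trans s0)//=; last first.
  exact: le_trans t1.
apply: ri_norm_indic_le; [exact: measurable_itv..|].
by move=> x /=; rewrite !in_itv/= => /andP[-> /lt_le_trans]; exact.
Qed.

(** A norm that vanished on the indicator function would make the interval
    negligible. *)
Lemma fundamental_gt0 X t : 0 < t <= 1 -> 0 < fundamental X t.
Proof.
move=> t01; have /andP[t0 t1] := t01.
have mE : measurable (`]0, t[%classic : set R) by exact: measurable_itv.
rewrite -lte_fin -fundamentalE// ri_norm_indicE lt0e.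
rewrite (fnorm_ge0 (ri_function_norm X)) ?andbT; last exact: Mplus_indic.
apply/eqP => /(fnorm_eq0 (ri_function_norm X) (Mplus_indic _ mE)).
move=> [N [mN N0 hN]].
have : (leb (`]0%R, t[%classic : set R) <= leb N)%E.
  apply: le_measure; rewrite ?inE// => x xt; apply: hN => /= h.
  have := h (subset_I01 _ t01 _ xt).
  by move=> /eqP; rewrite indicE mem_set// eqe oner_eq0.
by rewrite N0 lebesgue_measure_itv/= lte_fin t0 oppr0 adde0 lee_fin leNgt t0.
Qed.

Lemma fundamental_shift X a t : 0 <= a -> 0 < t -> a + t <= 1 ->
  ri_norm X (fun x => (\1_(`]a, (a + t)%R[%classic : set R) x)%:E) = (fundamental X t)%:E.
Proof.
move=> a0 t0 at1; have t01 : 0 < t <= 1 by rewrite t0 (le_trans _ at1)// lerDr.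
rewrite -fundamentalE//; apply: ri_norm_indic_eq; try exact: measurable_itv.
- move=> x /=; rewrite /I01/= !in_itv/= => /andP[/(le_lt_trans a0) -> /lt_le_trans]; exact.
- exact: subset_I01.
- by rewrite !lebesgue_measure_itv/= !lte_fin ltrDl t0 oppr0 adde0 -EFinB addrAC subrr add0r.
Qed.

(** The lower estimate is applied to the pieces of a step function lying below
    F; since the pieces are disjointly supported, their l^alpha-combination is
    that step function itself. *)
Lemma lower_estimate_step_function X alpha : 1 < alpha -> lower_estimate X alpha ->
  exists C : R, 0 < C /\
  forall (n : nat) (E : 'I_n -> set R) (x : 'I_n -> R) F,
    (forall i, measurable (E i)) -> (forall i, E i `<=` I01) ->
    trivIset setT E -> (forall i, 0 <= x i) ->
    Mplus F -> (forall i s, E i s -> ((x i)%:E <= F s)%E) ->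
    ((\sum_(i < n) ((x i)%:E * ri_norm X (fun s => (\1_(E i) s)%:E)) `^ alpha) `^ alpha^-1
      <= C%:E * ri_norm X F)%E.
Proof.
move=> a1 [C [C0 hC]]; exists C; split=> // n E x F mE EI tE x0 mF hF.
have a0 : 0 < alpha by exact: lt_trans a1.
pose f i s : \bar R := ((x i)%:E * (\1_(E i) s)%:E)%E.
have mf i : measurable_fun I01 (f i).
  by apply: measurable_funeM; apply/measurable_EFinP; exact: measurable_indic.
have f0 i s : (0 <= f i s)%E by rewrite mule_ge0// lee_fin.
have tf : trivIset setT (fun i => I01 `&` [set s | f i s != 0%E]).
  have fE i s : f i s != 0%E -> E i s.
    by rewrite /f indicE; case: (boolP (s \in E i)); rewrite ?inE// mule0 eqxx.
  move=> i j _ _ [s [[_ /= /fE si] [_ /= /fE sj]]].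
  by apply: tE => //; exists s.
have := hC n f mf tf.
rewrite (eq_bigr (fun i => ((x i)%:E * ri_norm X (fun s => (\1_(E i) s)%:E)) `^ alpha)%E);
  last first.
  move=> i _; congr (_ `^ _)%E; rewrite ri_norm_indicE -(fnormZ (ri_function_norm X))//.
    by congr (ri_fnorm X _); apply/funext => s; rewrite gee0_abs.
  exact: Mplus_indic.
move=> /le_trans; apply; rewrite lee_pmul2l ?lte_fin//.
have fN i s : ~ E i s -> f i s = 0%E.
  by move=> Es; rewrite /f indicE memNset//= mule0.
have mS : measurable_fun I01 (fun s => ((\sum_(i < n) `|f i s| `^ alpha) `^ alpha^-1)%E).
  apply: (measurableT_comp (measurable_poweR _)).
  apply: emeasurable_sum => i; apply: (measurableT_comp (measurable_poweR _)).
  exact: measurableT_comp.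
apply: (fnorm_mono (ri_function_norm X)).
- by apply: Mplus_abse; case: mF.
- exact: Mplus_abse.
apply: aeW => s sI; rewrite (gee0_abs (poweR_ge0 _ _)) gee0_abs; last by case: mF => _; exact.
have [[j Ej]|nE] := pselect (exists j, E j s); last first.
  rewrite big1 => [|i _]; last first.
    by rewrite fN ?abse0 ?poweR0r ?gt_eqF// => Es; apply: nE; exists i.
  by rewrite poweR0r ?gt_eqF ?invr_gt0//; case: mF => _; exact.
rewrite (bigD1 j)// big1 => [|i ij]; last first.
  rewrite fN ?abse0 ?poweR0r ?gt_eqF// => Es.
  by move: ij; rewrite (tE i j)// ?eqxx//; exists s.
rewrite [X in (X `^ _)%E]adde0 -poweRrM mulfV ?gt_eqF// poweRe1 ?abse_ge0// gee0_abs//.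
by rewrite /f indicE mem_set// mule1 hF.
Qed.

End Spaces.

(** * The functions psi and M *)

Section Weights.
Context {R : realType}.
Implicit Types (X : ri_space R) (psi M : R -> R).
Implicit Types (s t u alpha r l q : R).

Lemma dilation_ge M s t : 0 < s < 1 -> s * t < 1 ->
  ((M (s * t) / M s)%:E <= dilation M t)%E.
Proof. by move=> s01 st1; apply: ereal_sup_ubound; exists s. Qed.

Lemma dilation_fineK M t : dilation_finite M -> 0 < t <= 2 ->
  (fine (dilation M t))%:E = dilation M t.
Proof.
move=> fM /andP[t0 t2]; rewrite fineK// fin_numE; apply/andP; split.
  have /lt_eqF : (-oo < dilation M t)%E; last by rewrite eq_sym => ->.
  apply: lt_le_trans (dilation_ge M (4^-1) t _ _); first exact: ltNyr.
    by apply/andP; split; lra.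
  by nra.
by rewrite lt_eqF// fM.
Qed.

Lemma dilation_le M s t : dilation_finite M -> (forall u, 0 < u < 1 -> 0 < M u) ->
  0 < s < 1 -> 0 < t <= 2 -> s * t < 1 ->
  M (s * t) <= fine (dilation M t) * M s.
Proof.
move=> fM M0 s01 t02 st1; rewrite -ler_pdivrMr ?M0//.
by rewrite -lee_fin dilation_fineK// dilation_ge.
Qed.

Lemma dilation_gt0 M t : dilation_finite M -> (forall u, 0 < u < 1 -> 0 < M u) ->
  0 < t < 1 -> 0 < fine (dilation M t).
Proof.
move=> fM M0 /andP[t0 t1].
have h2 : 0 < (2^-1 : R) < 1 by apply/andP; split; lra.
have ht : 0 < 2^-1 * t < 1 by apply/andP; split; nra.
have /andP[_ ht1] := ht.
have t2 : 0 < t <= 2 by rewrite t0 (le_trans (ltW t1))// ler1n.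
have := dilation_le M 2^-1 t fM M0 h2 t2 ht1.
by move=> /(lt_le_trans (M0 _ ht)); rewrite pmulr_lgt0// M0.
Qed.

(** A function of lower index 0 satisfies dilation M l <= l^(-eps) for small l,
    whatever eps > 0, and powers of 1 - ln l are also smaller than any negative
    power of l; hence the factor l wins over both. On a logarithmic scale, with
    x = - ln l, each of the two costs at most x / 4 up to the constant K. *)
Lemma lower_index0_scale M alpha q : lower_index M 0 ->
  (forall u, 0 < u < 1 -> 0 < M u) -> 0 < alpha -> 0 < q ->
  exists l, [/\ 0 < l, l <= 2^-1 &
    l * ((1 - ln l) `^ q * fine (dilation M l) `^ alpha) <= 2^-1].
Proof.
move=> [fM hM] M0 a0 q0.
pose K := 1 / 4 - q * ln (4 * q)^-1.
have e0 : 0 < (4 * alpha)^-1 by rewrite invr_gt0 mulr_gt0.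
have : \forall t \near 0^'+, [/\ `|ln (fine (dilation M t)) / ln t| < (4 * alpha)^-1,
   0 < t, t < 2^-1 & t < expR (- (2 * (K + ln 2)))].
  near=> t; split.
  - near: t; have /cvgrPdist_lt /(_ _ e0) := hM.
    by apply: filterS => t; rewrite sub0r normrN.
  - by near: t; exact: nbhs_right_gt.
  - by near: t; apply: nbhs_right_lt; rewrite invr_gt0.
  - by near: t; apply: nbhs_right_lt; exact: expR_gt0.
move=> near0.
have [l [hl l0 l2 lK]] := @filter_ex _ _ (at_right_proper_filter 0) _ near0.
exists l; split=> //; first exact: ltW.
have l1 : l < 1 by lra.
have x0 : 0 < - ln l by rewrite oppr_gt0 ln_lt0// l0.
have xK : 2 * (K + ln 2) < - ln l.
  by rewrite ltrNr -ltr_expR lnK ?posrE.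
have m0 : 0 < fine (dilation M l) by apply: dilation_gt0; rewrite ?l0.
have y0 : 0 < 1 - ln l by lra.
rewrite -ler_ln ?posrE ?invr_gt0 ?mulr_gt0 ?powR_gt0//.
rewrite !lnM ?posrE ?mulr_gt0 ?powR_gt0// !ln_powR lnV ?posrE//.
have h1 : alpha * ln (fine (dilation M l)) <= - ln l / 4.
  have : ln (fine (dilation M l)) <= (4 * alpha)^-1 * - ln l.
    move: hl; rewrite normrM normfV (ltr0_norm (_ : ln l < 0)) -?oppr_gt0//.
    by rewrite ltr_pdivrMr// => /ltW; apply: le_trans; exact: ler_norm.
  move=> /(ler_wpM2l (ltW a0)) /le_trans; apply.
  by rewrite invfM mulrA [X in _ <= X]mulrC mulrCA mulrA mulfK ?gt_eqF.
have h2 : q * ln (1 - ln l) <= (1 - ln l) / 4 - q * ln (4 * q)^-1.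
  have c0 : 0 < (4 * q)^-1 by rewrite invr_gt0 mulr_gt0.
  have /ltW := ln_sublinear (mulr_gt0 y0 c0).
  rewrite lnM ?posrE// -lerBrDr => /(ler_wpM2l (ltW q0)) /le_trans; apply.
  rewrite mulrBr lerB// le_eqVlt; apply/orP; left; apply/eqP.
  by field; rewrite gt_eqF.
by move: h1 h2 xK; rewrite /K; lra.
Unshelve. all: by end_near. Qed.

Section Mfun.
Variables (psi : R -> R) (X : ri_space R).
Hypothesis hpsi : classA0 psi.

Let psi0 t : 0 < t < 1 -> 0 < psi t. Proof. by case: hpsi => h _ _ _ _; exact: h. Qed.
Let psin s t : 0 < s -> s <= t -> t < 1 -> psi s <= psi t.
Proof. by case: hpsi => _ h _ _ _; exact: h. Qed.
Let psid : dilation_finite psi. Proof. by case: hpsi. Qed.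

(** Doubling reduces s to s / 2, which lies below 1/2. *)
Lemma classA0_bounded s : 0 < s < 1 -> psi s <= fine (dilation psi 2) * psi 2^-1.
Proof.
move=> /andP[s0 s1]; have s2 : 0 < s / 2 < 1 by apply/andP; split; lra.
have e : s / 2 * 2 = s by field.
have := dilation_le psi (s / 2) 2 psid psi0 s2; rewrite e ltr0n lexx => /(_ isT s1) h.
apply: le_trans h _; rewrite ler_wpM2l//; last first.
  by apply: psin; lra.
rewrite fine_ge0//; apply: le_trans (dilation_ge psi 4^-1 2 _ _).
- by rewrite lee_fin divr_ge0// ltW// psi0//; apply/andP; split; lra.
- by apply/andP; split; lra.
- lra.
Qed.

Let S t := [set psi s / fundamental X s | s in `]t, 1[%classic].

(** The quotients are bounded above on ]t, 1[ because psi is bounded and the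
    fundamental function is at least its value at t, which is positive. *)
Lemma Mfun_has_sup t : 0 < t < 1 -> has_sup (S t).
Proof.
move=> /andP[t0 t1]; split.
  by exists (psi ((t + 1) / 2) / fundamental X ((t + 1) / 2)); exists ((t + 1) / 2) => //;
     rewrite /= in_itv/=; apply/andP; split; lra.
exists (fine (dilation psi 2) * psi 2^-1 / fundamental X t) => _ [s /= + <-].
rewrite in_itv/= => /andP[ts s1].
have s0 := lt_trans t0 ts.
apply: ler_pM.
- by rewrite ltW// psi0// s0.
- by rewrite invr_ge0 ltW// fundamental_gt0// s0 ltW.
- by apply: classA0_bounded; rewrite s0.
- rewrite lef_pV2 ?posrE.
  + by apply: fundamental_nondecreasing => //; exact: ltW.
  + by apply: fundamental_gt0; rewrite s0 ltW.
  + by apply: fundamental_gt0; rewrite t0 ltW.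
Qed.

Lemma Mfun_ge s t : 0 < t -> t < s -> s < 1 -> psi s / fundamental X s <= Mfun psi X t.
Proof.
move=> t0 ts s1; apply: ub_le_sup.
  by have [] : has_sup (S t) by apply: Mfun_has_sup; rewrite t0 (lt_trans ts).
by exists s => //=; rewrite in_itv/= ts.
Qed.

Lemma Mfun_gt0 t : 0 < t < 1 -> 0 < Mfun psi X t.
Proof.
move=> /andP[t0 t1]; apply: lt_le_trans (Mfun_ge ((t + 1) / 2) t t0 _ _); [|lra..].
rewrite divr_gt0 ?psi0 ?fundamental_gt0//; first by apply/andP; split; lra.
by apply/andP; split; lra.
Qed.

Lemma Mfun_nonincreasing s t : 0 < s -> s <= t -> t < 1 -> Mfun psi X t <= Mfun psi X s.
Proof.
move=> s0 st t1; have t01 : 0 < t < 1 by rewrite (lt_le_trans s0).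
apply: ge_sup; first by have [] := Mfun_has_sup t t01.
move=> _ [u /= + <-]; rewrite in_itv/= => /andP[tu u1].
by apply: Mfun_ge => //; exact: le_lt_trans tu.
Qed.

Lemma measurable_inv_classA0 : measurable_fun I01 (fun t => ((psi t)^-1)%:E).
Proof.
apply: nonincreasing_measurable_I01 => s t s0 st t1.
have s01 : 0 < s < 1 by rewrite s0 (le_lt_trans st).
have t01 : 0 < t < 1 by rewrite (lt_le_trans s0 st).
by rewrite lee_fin lef_pV2 ?posrE ?psi0// psin.
Qed.

End Mfun.
End Weights.

(** * A weighted Hardy inequality for f** *)

Section HardyMaximal.
Context {R : realType}.

Lemma cvg_geometric0 (l : R) : 0 < l < 1 -> l ^+ n.+1 @[n --> \oo] --> (0 : R).
Proof.
move=> /andP[l0 l1]; rewrite (cvg_shiftS (fun n => l ^+ n)).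
by apply: cvg_expr; rewrite gtr0_norm.
Qed.

Variables (f : R -> \bar R) (l alpha Z : R) (w : nat -> R).
Hypotheses (l01 : 0 < l < 1) (alpha1 : 1 < alpha) (w0 : forall k, 0 < w k).
Hypothesis hw : forall k, l * w k <= w k.+1 / 2.
Let t k := l ^+ k.+1.
Hypothesis ffin : forall k, rearr f (t k) \is a fin_num.
Let z k := fine (rearr f (t k.+1)).
Hypothesis hZ : forall n, \sum_(k < n) w k * z k `^ alpha <= Z.

Let l0 : 0 < l. Proof. by case/andP: l01. Qed.
Let l1 : l <= 1. Proof. by case/andP: l01 => _ /ltW. Qed.
Let a0 : 0 < alpha. Proof. exact: lt_trans alpha1. Qed.
Let t0 k : 0 < t k. Proof. exact: exprn_gt0. Qed.
Let tS k : t k.+1 = l * t k. Proof. by rewrite /t exprS. Qed.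
Let tn k : t k.+1 <= t k. Proof. by rewrite tS ger_pMl. Qed.
Let tle m n : (m <= n)%N -> t n <= t m.
Proof. by move=> mn; apply: ler_wiXn2l => //; exact: ltW. Qed.
Let z0 k : 0 <= z k. Proof. by apply: fine_ge0; exact: rearr_ge0. Qed.
Let Z0 : 0 <= Z. Proof. by have := hZ 0%N; rewrite big_ord0. Qed.

(** For the rearrangement truncated to [t_n, 1[ everything is finite and the
    average at t_n vanishes, so the contraction argument leaves no boundary term
    and gives a bound that does not depend on n. *)
Lemma truncated_maximal_bound k n :
  (\int[leb]_(s in `[t n, t k[) rearr f s <= (t k * (2 * Z / w k) `^ alpha^-1)%:E)%E.
Proof.
have B0 : 0 <= t k * (2 * Z / w k) `^ alpha^-1 by rewrite mulr_ge0 ?powR_ge0// ltW.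
have [kn|nk] := ltnP k n; last first.
  rewrite set_itv_ge ?integral_set0 ?lee_fin//.
  by rewrite bnd_simp -leNgt tle.
pose T k := (\int[leb]_(s in `[t n, t k[) rearr f s)%E.
have Tfin j : T j \is a fin_num.
  rewrite ge0_fin_numE; last by apply: integral_ge0 => x _; exact: rearr_ge0.
  have [tnj|jn] := leP (t n) (t j); last first.
    by rewrite /T set_itv_ge ?integral_set0 ?ltry// bnd_simp -leNgt ltW.
  apply: le_lt_trans (integral_rearr_itv_le f _ _ tnj) _.
  by rewrite -(fineK (ffin n)) -EFinM ltry.
have T0 j : 0 <= fine (T j).
  by apply: fine_ge0; apply: integral_ge0 => x _; exact: rearr_ge0.
pose a k := fine (T k) / t k.
have A0 j : 0 <= a j by rewrite divr_ge0// ltW.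
have rec j : (j < n)%N -> a j <= (1 - l) * z j + l * a j.+1.
  move=> jn; rewrite ler_pdivrMr// mulrDl.
  have -> : l * a j.+1 * t j = fine (T j.+1).
    by rewrite mulrAC -tS mulrC /a divfK// gt_eqF.
  have -> : (1 - l) * z j * t j = (t j - t j.+1) * z j by rewrite tS; ring.
  rewrite -lee_fin EFinD EFinM !fineK// /T.
  rewrite (integral_rearr_split f (BLeft (t n)) (t j.+1) (t j)) ?bnd_simp ?tle//.
  rewrite addeC leeD2r//.
  exact: integral_rearr_itv_le.
have := weighted_sum_contraction alpha l a w z n (ltW alpha1) _
  A0 (fun k => ltW (w0 k)) z0 hw rec.
rewrite (ltW l0) l1 => /(_ isT).
have -> : a n = 0 by rewrite /a /T set_itv_ge ?integral_set0 ?mul0r// bnd_simp -leNgt.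
rewrite powR0 ?gt_eqF// mulr0 addr0 => h.
have h2 : w k * a k `^ alpha <= 2 * Z.
  apply: le_trans (le_trans h _); last by rewrite ler_wpM2l.
  rewrite (bigD1 (Ordinal kn))//= lerDl sumr_ge0// => i _.
  by rewrite mulr_ge0 ?powR_ge0// ltW.
rewrite -/(T k) -(fineK (Tfin k)) lee_fin -ler_pdivrMl// mulrC -/(a k).
apply: le_root_powR => //.
by rewrite ler_pdivlMr// mulrC.
Qed.

Lemma maximal_bound k : (maximal f (t k) <= ((2 * Z / w k) `^ alpha^-1)%:E)%E.
Proof.
rewrite -(@lee_pmul2l _ (t k)%:E) ?lte_fin// -primitiveE// -EFinM.
apply: (integral_rearr_le_sup f t) => //; last by move=> n; exact: truncated_maximal_bound.
exact: cvg_geometric0.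
Qed.

Lemma maximal_finite k : maximal f (t k) \is a fin_num.
Proof.
by rewrite ge0_fin_numE ?maximal_ge0// (le_lt_trans (maximal_bound k))// ltry.
Qed.

(** The contraction argument for f** itself. Its boundary term
    w_n f**(t_n)^alpha is at most 2 Z by the bound obtained from truncation. *)
Lemma maximal_weighted_sum n :
  \sum_(k < n) w k * fine (maximal f (t k)) `^ alpha <= 4 * Z.
Proof.
pose a k := fine (maximal f (t k)).
have A0 j : 0 <= a j by apply: fine_ge0; exact: maximal_ge0.
have rec j : (j < n)%N -> a j <= (1 - l) * z j + l * a j.+1.
  move=> _; rewrite -lee_fin EFinD !EFinM !fineK ?maximal_finite ?ffin// tS.
  by apply: maximal_dilation; rewrite ?l0.
have := weighted_sum_contraction alpha l a w z n (ltW alpha1) _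
  A0 (fun k => ltW (w0 k)) z0 hw rec.
rewrite (ltW l0) l1 => /(_ isT) /le_trans; apply.
have -> : 4 * Z = 2 * Z + 2 * Z by ring.
apply: lerD; first by rewrite ler_wpM2l.
rewrite mulrC -ler_pdivlMr//.
have : a n <= (2 * Z / w n) `^ alpha^-1.
  by rewrite -lee_fin fineK ?maximal_finite// maximal_bound.
have h0 : 0 <= 2 * Z / w n by rewrite divr_ge0 ?mulr_ge0// ltW.
move=> /(ge0_ler_powR (ltW a0)); rewrite !nnegrE powR_ge0 => /(_ (A0 n) isT).
by rewrite -powRrM mulVf ?gt_eqF// powRr1.
Qed.

End HardyMaximal.

(** * Oscillation along a geometric sequence *)

Section OscillationSum.
Context {R : realType}.

(** On the intervals ]t_k, 2 t_k[, which are disjoint because l <= 1/2, the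
    function O^(1/r)/psi is at least c O(t_k)^(1/r)/psi(t_k), for a constant c
    that comes from t O(t) being nondecreasing and psi being doubling. These indicator functions have norm
    phi_X(t_k), and psi(t_k)/phi_X(t_k) <= M(t_(k+1)) <= m M(t_k), where m is
    the value at l of the dilation function of M. *)
Lemma oscillation_sum (X : ri_space R) (psi : R -> R) (alpha r l : R) :
  classA0 psi -> 1 < alpha -> lower_estimate X alpha -> 0 < r ->
  0 < l <= 2^-1 -> dilation_finite (Mfun psi X) ->
  exists C : R, 0 < C /\ forall f : R -> \bar R,
    (\int[leb]_(s in I01) rearr (fun x => `|f x|%E `^ r) s < +oo)%E ->
    (ri_norm X (fun t => osc f r t `^ r^-1 * ((psi t)^-1)%:E) < +oo)%E ->
    forall n, \sum_(k < n) (fine (osc f r (l ^+ k.+1)) `^ r^-1 /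
                            Mfun psi X (l ^+ k.+1)) `^ alpha <=
      C * fine (ri_norm X (fun t => osc f r t `^ r^-1 * ((psi t)^-1)%:E)%E) `^ alpha.
Proof.
move=> hpsi a1 hX r0 /andP[l0 l2] fM.
have [psi0 psin psid _ _] := hpsi.
have a0 : 0 < alpha by exact: lt_trans a1.
have l1 : l < 1 by lra.
pose t k := l ^+ k.+1.
have t0 k : 0 < t k by exact: exprn_gt0.
have tS k : t k.+1 = l * t k by rewrite /t exprS.
have tle m n : (m <= n)%N -> t n <= t m.
  by move=> mn; apply: ler_wiXn2l => //; exact: ltW.
have t2 k : t k + t k <= 1.
  have := tle 0%N k (leq0n k); rewrite {2}/t expr1; lra.
have t01 k : 0 < t k < 1 by rewrite t0/=; have := t2 k; have := t0 k; lra.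
have t01' k : 0 < t k <= 1 by rewrite t0/=; have := t2 k; have := t0 k; lra.
have [C [C0 hC]] := lower_estimate_step_function X alpha a1 hX.
pose m2 := fine (dilation psi 2).
have hm2 s : 0 < s < 2^-1 -> psi (s * 2) <= m2 * psi s.
  move=> /andP[s0 s2]; have s1 : 0 < s < 1 by apply/andP; split; lra.
  have s2' : s * 2 < 1 by lra.
  by apply: dilation_le; rewrite ?ltr0n ?lexx.
have m20 : 0 < m2.
  have h4 : 0 < (4^-1 : R) < 2^-1 by apply/andP; split; lra.
  have p1 : 0 < psi (4^-1 * 2) by apply: psi0; apply/andP; split; lra.
  have p2 : 0 < psi 4^-1 by apply: psi0; apply/andP; split; lra.
  by have := lt_le_trans p1 (hm2 _ h4); rewrite pmulr_lgt0.
pose M := Mfun psi X.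
have M0 u : 0 < u < 1 -> 0 < M u by exact: Mfun_gt0.
pose m := fine (dilation M l).
have m0 : 0 < m by apply: dilation_gt0; rewrite ?l0.
have r0' : 0 <= r^-1 by rewrite invr_ge0 ltW.
pose c := 2^-1 `^ r^-1 / m2.
have c0 : 0 < c by rewrite divr_gt0 ?powR_gt0.
exists ((m / c) `^ alpha * C `^ alpha).
split; first by rewrite mulr_gt0 ?powR_gt0 ?divr_gt0.
move=> f kfin.
set k := (fun x => (`|f x| `^ r)%E) in kfin.
set F := (fun t => osc f r t `^ r^-1 * ((psi t)^-1)%:E)%E => AF n.
have mF : measurable_fun I01 F.
  apply: emeasurable_funM; last exact: measurable_inv_classA0.
  by apply: (measurableT_comp (measurable_poweR _)); exact: measurable_osc.
have mF' := Mplus_abse F mF.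
have A0 : (0 <= ri_norm X F)%E by exact: (fnorm_ge0 (ri_function_norm X)).
have Afin : ri_norm X F \is a fin_num by rewrite ge0_fin_numE.
have oscE u : 0 < u < 1 -> osc f r u = (fine (osc f r u))%:E.
  move=> /andP[u0 u1]; rewrite fineK// fin_numB.
  by rewrite (maximal_fin_num _ kfin) ?(rearr_fin_num _ kfin)// u0 ltW.
have o0 u : 0 < u < 1 -> 0 <= fine (osc f r u).
  by move=> /andP[u0 u1]; apply: (osc_ge0 k kfin); rewrite u0 ltW.
pose x i := c * (fine (osc f r (t i)) `^ r^-1 / psi (t i)).
have x0 i : 0 <= x i.
  by rewrite mulr_ge0 ?(ltW c0)// divr_ge0 ?powR_ge0// ltW// psi0.
pose E i : set R := `]t i, (t i + t i)%R[%classic.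
have EI i : E i `<=` I01.
  move=> s; rewrite /E /I01/= !in_itv/= => /andP[h1 h2].
  by rewrite (lt_trans (t0 i) h1) (lt_le_trans h2).
have mE i : measurable (E i) by exact: measurable_itv.
have Edisj i j s : (i < j)%N -> E i s -> ~ E j s.
  move=> ij; rewrite /E/= !in_itv/= => /andP[h1 _] /andP[_ h2].
  have := tle _ _ ij; rewrite tS; have := t0 i; nra.
have tE : trivIset setT (fun i : 'I_n => E i).
  move=> i j _ _ [s [si sj]]; apply/val_inj.
  by case: (ltngtP i j) => // ij; [case: (Edisj _ _ _ ij si)|case: (Edisj _ _ _ ij sj)].
have hF i s : E i s -> ((x i)%:E <= `|F s|)%E.
  move=> Es; have := EI _ _ Es; rewrite /I01/= in_itv/= => s01.
  have /andP[s0 s1] := s01.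
  move: Es; rewrite /E/= in_itv/= => /andP[ts st].
  rewrite /F (oscE s s01) poweR_EFin -EFinM abse_EFin lee_fin.
  apply: le_trans (ler_norm _).
  rewrite /x /c mulrACA -invfM; apply: ler_pM.
  - by rewrite mulr_ge0 ?powR_ge0.
  - by rewrite invr_ge0 mulr_ge0 ?ltW// psi0.
  - have oi := o0 _ (t01 i); have os := o0 s s01.
    rewrite -powRM//; apply: ge0_ler_powR; rewrite ?nnegrE ?mulr_ge0//.
    have := mul_osc_nondecreasing k kfin (t i) s (t0 i) (ltW ts) (ltW s1).
    rewrite -/(osc f r (t i)) -/(osc f r s).
    have := o0 s s01; have := o0 (t i) (t01 i); have := t0 i; nra.
  - rewrite lef_pV2 ?posrE ?mulr_gt0 ?psi0//.
    have h2 : 0 < s / 2 < 2^-1 by apply/andP; split; lra.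
    have := hm2 _ h2; rewrite divfK// => /le_trans; apply.
    rewrite ler_wpM2l ?(ltW m20)//; apply: psin; [lra|lra|].
    by have /andP[] := t01 i.
have := hC n (fun i => E i) (fun i => x i) _ (fun i => mE i) (fun i => EI i) tE
  (fun i => x0 i) mF' (fun i => hF i).
have -> : ri_norm X (fun s => `|F s|%E) = ri_norm X F.
  by congr (ri_fnorm X _); apply/funext => s; rewrite abse_id.
under eq_bigr => i _.
  rewrite (fundamental_shift X (t i) (t i) (ltW (t0 i)) (t0 i) (t2 i)) -EFinM poweR_EFin.
  over.
rewrite sumEFin poweR_EFin -(fineK Afin) -EFinM lee_fin => hS.
set A := fine (ri_norm X F) in hS *.
have {}hS : \sum_(i < n) (x i * fundamental X (t i)) `^ alpha <= C `^ alpha * A `^ alpha.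
  have S0 : 0 <= \sum_(i < n) (x i * fundamental X (t i)) `^ alpha.
    by rewrite sumr_ge0// => i _; exact: powR_ge0.
  rewrite -powRM ?(ltW C0) ?fine_ge0//.
  have := ge0_ler_powR (ltW a0) _ _ hS.
  rewrite !nnegrE powR_ge0 mulr_ge0 ?(ltW C0) ?fine_ge0//.
  by rewrite -powRrM mulVf ?gt_eqF// powRr1//; exact.
rewrite -mulrA; apply: le_trans (ler_wpM2l (powR_ge0 _ _) hS).
rewrite mulr_sumr; apply: ler_sum => i _.
have ph0 : 0 < fundamental X (t i) by exact: fundamental_gt0.
have ps0 := psi0 _ (t01 i).
have mc0 : 0 <= m / c by rewrite divr_ge0// ltW.
have xp0 : 0 <= x i * fundamental X (t i) by rewrite mulr_ge0// ltW.
rewrite -powRM//.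
have Mi := M0 _ (t01 i).
apply: ge0_ler_powR; rewrite ?(ltW a0) ?nnegrE//.
- by rewrite divr_ge0 ?powR_ge0// ltW.
- by rewrite mulr_ge0.
rewrite ler_pdivrMr//.
have h1 : psi (t i) / fundamental X (t i) <= m * M (t i).
  apply: (@le_trans _ _ (M (t i.+1))).
    apply: Mfun_ge => //; last by have /andP[] := t01 i.
    by rewrite tS gtr_pMl.
  have := dilation_le M (t i) l fM M0 (t01 i).
  rewrite mulrC -tS l0 => /(_ _ _); apply; first lra.
  by have /andP[] := t01 i.+1.
have -> : m / c * (x i * fundamental X (t i)) * M (t i) =
   fine (osc f r (t i)) `^ r^-1 * ((m * M (t i)) * (fundamental X (t i) / psi (t i))).
  by rewrite /x; field; rewrite !gt_eqF.
rewrite ler_peMr ?powR_ge0//.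
by rewrite mulrA ler_pdivlMr// mul1r -ler_pdivrMr.
Qed.

End OscillationSum.

(** * From sums to the weighted integral *)

Section WeightedIntegral.
Context {R : realType}.

Lemma I01_bigcup_geometric (l : R) : 0 < l < 1 ->
  I01 = \bigcup_k `[l ^+ k.+1, l ^+ k[%classic.
Proof.
move=> l01; have /andP[l0 l1] := l01.
apply/seteqP; split=> [x|x [k _ /=]]; rewrite /I01/= !in_itv/= => /andP[h1 h2].
  have ex : exists k, l ^+ k.+1 <= x.
    have /cvgr_le /(_ _ h1)[n _ /(_ n (leqnn n)) h] := cvg_geometric0 l l01.
    by exists n.
  exists (ex_minn ex) => //=; rewrite in_itv/=.
  case: ex_minnP => -[|k] -> hk /=; first by rewrite expr0.
  by rewrite ltNge; apply/negP => /hk; rewrite ltnn.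
rewrite (lt_le_trans _ h1) ?exprn_gt0//= (lt_le_trans h2)//.
by rewrite exprn_ile1 ?ltW.
Qed.

Variables (l alpha : R) (V : R -> R).
Hypotheses (l01 : 0 < l < 1) (a0 : 0 < alpha).
Hypothesis V0 : forall t, 0 < t < 1 -> 0 < V t.
Hypothesis Vn : forall s t, 0 < s -> s <= t -> t < 1 -> V t <= V s.
Hypothesis Vl : forall t, 0 < t < 1 -> l * V (l * t) `^ alpha <= V t `^ alpha / 2.

(** The sign change makes 1/V monotone in the direction that
    [nonincreasing_measurable_I01] requires. *)
Lemma measurable_weighted_maximal (f : R -> \bar R) : measurable_fun I01
  (fun t => (maximal f t * ((V t)^-1)%:E) `^ alpha * (t^-1)%:E)%E.
Proof.
apply: emeasurable_funM; last first.
  apply: nonincreasing_measurable_I01 => s t s0 st t1.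
  by rewrite lee_fin lef_pV2 ?posrE// (lt_le_trans s0).
apply: (measurableT_comp (measurable_poweR _)).
apply: emeasurable_funM; first exact: measurable_maximal.
rewrite (_ : (fun t => _) = (fun t => - ((- (V t)^-1)%:E))%E); last first.
  by apply/funext => t; rewrite EFinN oppeK.
apply: measurableT_comp => //.
apply: nonincreasing_measurable_I01 => s t s0 st t1.
have s01 : 0 < s < 1 by rewrite s0 (le_lt_trans st).
have t01 : 0 < t < 1 by rewrite (lt_le_trans s0).
by rewrite lee_fin lerN2 lef_pV2 ?posrE ?V0// Vn.
Qed.

(** On [t_k, t_k / l[ the function f** is at most f**(t_k), and dt/t has mass at
    most 1 / l. Since V is nonincreasing, it is V(l t) and not V(t) that is at
    least V(t_k); [Vl] brings V(l t) back to V(t) at the price of the factor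
    1 / (2 l). *)
Lemma weighted_maximal_integral (f : R -> \bar R) (K : R) :
  (forall k, maximal f (l ^+ k.+1) \is a fin_num) ->
  (forall n, \sum_(k < n) (V (l ^+ k.+1) `^ alpha)^-1 *
     fine (maximal f (l ^+ k.+1)) `^ alpha <= K) ->
  (\int[leb]_(t in I01) ((maximal f t * ((V t)^-1)%:E) `^ alpha * (t^-1)%:E) <=
   (K / (2 * l ^+ 2))%:E)%E.
Proof.
move=> Dfin hK; have /andP[l0 l1] := l01.
pose t k := l ^+ k.+1.
have t0 k : 0 < t k by exact: exprn_gt0.
have t01 k : 0 < t k < 1 by rewrite t0 exprn_ilt1 ?ltW.
set phi := (fun t => (maximal f t * ((V t)^-1)%:E) `^ alpha * (t^-1)%:E)%E.
pose J k : set R := `[l ^+ k.+1, l ^+ k[%classic.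
have JI k : J k `<=` I01 by rewrite (I01_bigcup_geometric l l01) => x Jx; exists k.
have mJ k : measurable (J k) by exact: measurable_itv.
have phi0 x : I01 x -> (0 <= phi x)%E.
  rewrite /I01/= in_itv/= => /andP[x0 x1].
  by rewrite mule_ge0 ?poweR_ge0// lee_fin invr_ge0 ltW.
have mphi : measurable_fun I01 phi by exact: measurable_weighted_maximal.
pose D k := fine (maximal f (t k)).
pose w k := (V (t k) `^ alpha)^-1.
have D0 k : 0 <= D k by apply: fine_ge0; exact: maximal_ge0.
have w0 k : 0 < w k by rewrite invr_gt0 powR_gt0// V0.
have intJ k : (\int[leb]_(x in J k) phi x <= (w k * D k `^ alpha / (2 * l ^+ 2))%:E)%E.
  pose c := D k `^ alpha * (w k / (2 * l)) * (t k)^-1.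
  have c0 : 0 <= c.
    rewrite mulr_ge0 ?invr_ge0 ?(ltW (t0 k))// mulr_ge0 ?powR_ge0//.
    by rewrite divr_ge0 ?(ltW (w0 k))// mulr_ge0// ltW.
  apply: (@le_trans _ _ (\int[leb]_(x in J k) cst c%:E x)%E).
    apply: ge0_le_integral => //=.
    - exact: measurable_itv.
    - by move=> x Jx; exact: phi0 (JI _ _ Jx).
    - by apply: (measurable_funS _ (JI k) mphi); exact: measurable_itv.
    - move=> x Jx; have := JI _ _ Jx; rewrite /I01/= in_itv/= => x01.
      have /andP[x0 x1] := x01.
      move: Jx; rewrite /J/= in_itv/= => /andP[tx xt].
      rewrite /c EFinM lee_pmul//.
      + exact: poweR_ge0.
      + by rewrite lee_fin invr_ge0 ltW.
      + have Vi0 : (0 <= ((V x)^-1)%:E)%E by rewrite lee_fin invr_ge0 ltW// V0.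
        rewrite poweRM ?maximal_ge0// EFinM lee_pmul ?poweR_ge0//.
          rewrite -poweR_EFin /D (fineK (Dfin k)).
          apply: (gt0_ler_poweR (ltW a0)) => //.
          - by rewrite in_itv/= leey maximal_ge0.
          - by rewrite in_itv/= leey maximal_ge0// t0.
          - exact: (maximal_nonincreasing _ _ _ (t0 k) tx).
        have Vx := V0 _ x01; have Vk := V0 _ (t01 k).
        have lx0 : 0 < l * x by exact: mulr_gt0.
        have lxk : l * x <= t k by rewrite /t exprS ler_wpM2l// ltW.
        rewrite poweR_EFin lee_fin.
        have -> : (V x)^-1 `^ alpha = (V x `^ alpha)^-1.
          apply: (mulIf (lt0r_neq0 (powR_gt0 alpha Vx))).
          by rewrite mulVf ?gt_eqF ?powR_gt0// -powRM ?invr_ge0 ?ltW// mulVf ?gt_eqF// powR1.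
        rewrite /w -invfM lef_pV2 ?posrE ?mulr_gt0 ?powR_gt0//.
        have : V (t k) `^ alpha <= V (l * x) `^ alpha.
          apply: ge0_ler_powR; rewrite ?nnegrE ?(ltW a0) ?(ltW Vk)//.
            by apply/ltW/V0; rewrite lx0 (le_lt_trans lxk)//; have /andP[] := t01 k.
          by apply: Vn => //; have /andP[] := t01 k.
        by move=> /(ler_wpM2l (ltW l0)); have := Vl x x01; lra.
      + by rewrite lee_fin lef_pV2 ?posrE.
  have lk : 0 < l ^+ k by exact: exprn_gt0.
  have lkS : l ^+ k.+1 < l ^+ k by rewrite exprS gtr_pMl.
  have -> : (\int[leb]_(x in J k) cst c%:E x = (c * (l ^+ k - l ^+ k.+1))%:E)%E.
    rewrite integral_cst ?EFinM; last exact: measurable_itv; congr (_ * _)%E.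
    by rewrite [LHS]lebesgue_measure_itv/= lte_fin lkS -EFinB.
  rewrite lee_fin.
  apply: (@le_trans _ _ (c * l ^+ k)).
    by rewrite ler_wpM2l// gerBl ltW ?exprn_gt0.
  rewrite le_eqVlt; apply/orP; left; apply/eqP.
  by rewrite /c /t exprS; field; rewrite !gt_eqF.
rewrite (I01_bigcup_geometric l l01) ge0_integral_bigcup//; last 3 first.
- by rewrite -(I01_bigcup_geometric l l01).
- by rewrite -(I01_bigcup_geometric l l01).
- have disj i j s : (i < j)%N -> J i s -> ~ J j s.
    move=> ij; rewrite /J/= !in_itv/= => /andP[h1 _] /andP[_ h2].
    have : l ^+ j <= l ^+ i.+1 by apply: ler_wiXn2l; rewrite // ltW.
    by move=> /(lt_le_trans h2); rewrite ltNge h1.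
  move=> i j _ _ [s [si sj]].
  by case: (ltngtP i j) => // ij; [case: (disj _ _ _ ij si)|case: (disj _ _ _ ij sj)].
apply: lime_le; first by apply: is_cvg_nneseries => k _ _; apply: integral_ge0 => x /JI /phi0.
apply: nearW => n.
apply: (@le_trans _ _ (\sum_(0 <= k < n) (w k * D k `^ alpha / (2 * l ^+ 2))%:E)%E).
  by apply: lee_sum => k _; exact: intJ.
rewrite sumEFin lee_fin -mulr_suml ler_pM2r ?invr_gt0 ?mulr_gt0 ?exprn_gt0//.
by rewrite big_mkord; exact: hK.
Qed.

End WeightedIntegral.

(** * The logarithmic weight *)

Section LogarithmicWeight.
Context {R : realType}.
Variables (r alpha l m : R) (M : R -> R).
Hypotheses (r0 : 0 < r) (alpha1 : 1 < alpha) (r1 : r <= 1) (l01 : 0 < l < 1) (m0 : 0 < m).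
Hypothesis M0 : forall t, 0 < t < 1 -> 0 < M t.
Hypothesis Mn : forall s t, 0 < s -> s <= t -> t < 1 -> M t <= M s.
Hypothesis Ml : forall t, 0 < t < 1 -> M (l * t) <= m * M t.
Hypothesis hl : l * ((1 - ln l) `^ (alpha / r) * m `^ alpha) <= 2^-1.
Let p := alpha / r.
Let V t := ln (expR 1 / t) `^ r^-1 * M t.

Let l0 : 0 < l. Proof. by case/andP: l01. Qed.
Let a0 : 0 < alpha. Proof. exact: lt_trans alpha1. Qed.
Let p1 : 1 < p. Proof. by rewrite ltr_pdivlMr// mul1r (le_lt_trans r1). Qed.
Let p0 : 0 < p. Proof. exact: lt_trans p1. Qed.

Lemma ln_e_div (t : R) : 0 < t -> ln (expR 1 / t) = 1 - ln t :> R.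
Proof. by move=> t0; rewrite ln_div ?posrE ?expR_gt0// expRK. Qed.

Lemma ln_e_div_ge1 (t : R) : 0 < t < 1 -> 1 <= ln (expR 1 / t) :> R.
Proof.
by move=> /andP[t0 t1]; rewrite ln_e_div// lerDl oppr_ge0 ltW// ln_lt0// t0.
Qed.

Let L0 (t : R) : 0 < t < 1 -> 0 < ln (expR 1 / t).
Proof. by move=> /ln_e_div_ge1; exact: lt_le_trans. Qed.

Lemma log_weight_gt0 t : 0 < t < 1 -> 0 < V t.
Proof. by move=> t01; rewrite mulr_gt0 ?powR_gt0 ?M0 ?L0. Qed.

Lemma log_weight_nonincreasing s t : 0 < s -> s <= t -> t < 1 -> V t <= V s.
Proof.
move=> s0 st t1; have t0 := lt_le_trans s0 st.
have t01 : 0 < t < 1 by rewrite t0.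
have s01 : 0 < s < 1 by rewrite s0 (le_lt_trans st).
apply: ler_pM; rewrite ?powR_ge0 ?Mn ?(ltW (M0 _ _))//.
apply: ge0_ler_powR; rewrite ?nnegrE ?(ltW (L0 _ _))//.
  by rewrite invr_ge0 ltW.
by rewrite !ln_e_div// lerD2l lerN2 ler_ln ?posrE.
Qed.

Lemma log_weight_powR t : 0 < t < 1 ->
  V t `^ alpha = ln (expR 1 / t) `^ p * M t `^ alpha.
Proof.
move=> t01; rewrite powRM ?powR_ge0 ?(ltW (M0 _ _))//.
by rewrite -powRrM (mulrC r^-1).
Qed.

(** ln(e/(l t)) <= (1 - ln l) ln(e/t), as both factors are at least 1. *)
Lemma log_weight_dilation t : 0 < t < 1 -> l * V (l * t) `^ alpha <= V t `^ alpha / 2.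
Proof.
move=> t01; have /andP[t0 t1] := t01; have /andP[_ l1] := l01.
have lt01 : 0 < l * t < 1 by rewrite mulr_gt0//=; nra.
have Ll : 1 <= 1 - ln l by rewrite lerDl oppr_ge0 ltW// ln_lt0.
have Lt := ln_e_div_ge1 t t01.
rewrite !log_weight_powR//.
apply: (@le_trans _ _ (l * (((1 - ln l) * ln (expR 1 / t)) `^ p * (m * M t) `^ alpha))).
  rewrite ler_wpM2l ?(ltW l0)//; apply: ler_pM; rewrite ?powR_ge0//.
    apply: ge0_ler_powR; rewrite ?(ltW p0) ?nnegrE ?(ltW (L0 _ _))//.
      by rewrite mulr_ge0// (le_trans ler01).
    move: Lt; rewrite !ln_e_div// ?mulr_gt0// lnM ?posrE//; nra.
  apply: ge0_ler_powR; rewrite ?(ltW a0) ?nnegrE ?(ltW (M0 _ _)) ?Ml//.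
  by rewrite mulr_ge0 ?ltW// M0.
have Mt := M0 _ t01.
rewrite (powRM _ (le_trans ler01 Ll) (le_trans ler01 Lt)) (powRM _ (ltW m0) (ltW Mt)).
have := ler_wpM2r (mulr_ge0 (powR_ge0 (ln (expR 1 / t)) p) (powR_ge0 (M t) alpha)) hl.
rewrite -/p; lra.
Qed.

Let t k := l ^+ k.+1.
Let t01 k : 0 < t k < 1.
Proof. by have /andP[_ l1] := l01; rewrite exprn_gt0// exprn_ilt1 ?ltW. Qed.

(** ln(e/t_k) = 1 + (k + 1) (- ln l) is bounded below by a multiple of k + 1,
    which produces the averages of Hardy's inequality. *)
Lemma log_weight_invM k (b : R) : 0 <= b ->
  (V (t k) `^ alpha)^-1 * b `^ p <=
  (- ln l)^-1 `^ p * (b * M (t k) `^ (- r) / k.+1%:R) `^ p.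
Proof.
move=> b0; have Mk := M0 _ (t01 k); have Lk := L0 _ (t01 k).
have /andP[_ l1] := l01.
have x0 : 0 < - ln l by rewrite oppr_gt0 ln_lt0// l0.
have k0 : (0 : R) < k.+1%:R by [].
have hL : k.+1%:R * - ln l <= ln (expR 1 / t k).
  have e : ln (t k) = k.+1%:R * ln l by rewrite lnXn// mulr_natl.
  by rewrite ln_e_div ?exprn_gt0// e mulrN lerDr.
have bM0 : 0 <= b * M (t k) `^ (- r) by rewrite mulr_ge0 ?powR_ge0.
have -> : (V (t k) `^ alpha)^-1 * b `^ p =
    (b * M (t k) `^ (- r) / ln (expR 1 / t k)) `^ p.
  have V0 : V (t k) `^ alpha != 0 by rewrite gt_eqF// powR_gt0// log_weight_gt0.
  apply: (mulfI V0); rewrite mulrA divff// mul1r log_weight_powR//.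
  have -> : M (t k) `^ alpha = (M (t k) `^ r) `^ p.
    by rewrite -powRrM mulrC divfK ?gt_eqF.
  rewrite -!powRM ?mulr_ge0 ?powR_ge0 ?invr_ge0 ?(ltW Lk)//; congr (_ `^ _).
  rewrite powRN; field; rewrite !gt_eqF ?powR_gt0//.
rewrite -powRM ?invr_ge0 ?(ltW x0) ?divr_ge0//.
apply: ge0_ler_powR; rewrite ?nnegrE ?(ltW p0) ?divr_ge0 ?(ltW Lk)//.
  by rewrite mulr_ge0 ?divr_ge0// invr_ge0 ltW.
rewrite mulrCA ler_wpM2l// -invfM lef_pV2 ?posrE ?mulr_gt0//.
by rewrite mulrC.
Qed.

End LogarithmicWeight.

(** * The embedding *)

Lemma integral_rearr_Lr_norm (R : realType) (r : R) (f : R -> \bar R) :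
  0 < r -> measurable_fun I01 f ->
  (\int[leb]_(s in I01) rearr (fun x => `|f x| `^ r) s <= Lr_norm r f `^ r)%E.
Proof.
move=> r0 mf; rewrite /Lr_norm -poweRrM mulVf ?gt_eqF// poweRe1; last first.
  by apply: integral_ge0 => x _; exact: poweR_ge0.
have mfr : measurable_fun I01 (fun x => `|f x| `^ r)%E.
  by apply: (measurableT_comp (measurable_poweR _)); exact: measurableT_comp.
apply: le_trans (integral_rearr_le _ mfr) _.
rewrite le_eqVlt; apply/orP; left; apply/eqP; apply: eq_integral => x _.
by rewrite gee0_abs// poweR_ge0.
Qed.

Theorem theorem14 (R : realType) (r alpha : R) (psi : R -> R) (X : ri_space R)
  (hr : 0 < r <= 1)
  (hpsi : classA0 psi)
  (halpha : 1 < alpha)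
  (hX : lower_estimate X alpha)
  (hassoc : assoc_norm (convexification r^-1 (ri_norm X))
              (fun s => (psi s `^ r / s)%:E) = +oo%E)
  (hMlow : lower_index (Mfun psi X) 0)
  (hMup : upper_index (Mfun psi X) 0) :
  exists C : R, 0 < C /\
    forall f : R -> \bar R, L0 f ->
      (H_norm alpha r (Mfun psi X) f <=
       C%:E * (ri_norm X (fun t => (osc f r t) `^ r^-1 * ((psi t)^-1)%:E)
               + Lr_norm r f))%E.
Proof.
have /andP[r0 r1] := hr.
have a0 : 0 < alpha by exact: lt_trans halpha.
pose p := alpha / r.
have p1 : 1 < p by rewrite ltr_pdivlMr// mul1r (le_lt_trans r1).
have p0 : 0 < p by exact: lt_trans p1.
have rp : r * p = alpha by rewrite mulrC divfK ?gt_eqF.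
have [fM _] := hMlow.
pose M := Mfun psi X.
have M0 u : 0 < u < 1 -> 0 < M u by exact: Mfun_gt0.
have Mn s t : 0 < s -> s <= t -> t < 1 -> M t <= M s by exact: Mfun_nonincreasing.
have [l [l0 l2 hl]] := lower_index0_scale M alpha p hMlow M0 a0 p0.
have l01 : 0 < l < 1 by rewrite l0; lra.
have /andP[_ l1] := l01.
pose m := fine (dilation M l).
have m0 : 0 < m by exact: dilation_gt0.
pose t k := l ^+ k.+1.
have t01 k : 0 < t k < 1 by rewrite exprn_gt0// exprn_ilt1 ?ltW.
have t0 k : 0 < t k by have /andP[] := t01 k.
have tS k : t k.+1 = l * t k by rewrite /t exprS.
have t01' k : 0 < t k <= 1 by rewrite t0 ltW//; have /andP[] := t01 k.
have Ml u : 0 < u < 1 -> M (l * u) <= m * M u.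
  move=> u01; rewrite mulrC; have /andP[u0 u1] := u01.
  apply: dilation_le; rewrite ?l0//; first lra.
  by nra.
pose V u := ln (expR 1 / u) `^ r^-1 * M u.
pose w k := (V (t k) `^ alpha)^-1.
have V0 : forall u, 0 < u < 1 -> 0 < V u by exact: log_weight_gt0.
have Vn : forall s u, 0 < s -> s <= u -> u < 1 -> V u <= V s.
  exact: log_weight_nonincreasing.
have Vl : forall u, 0 < u < 1 -> l * V (l * u) `^ alpha <= V u `^ alpha / 2.
  exact: (log_weight_dilation r alpha l m M).
have w0 k : 0 < w k by rewrite invr_gt0 powR_gt0// V0.
have hw k : l * w k <= w k.+1 / 2.
  by apply: inv_half_le; rewrite ?powR_gt0 ?V0// tS; exact: Vl.
have l2' : 0 < l <= 2^-1 by rewrite l0.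
have [C1 [C10 hC1]] := oscillation_sum X psi alpha r l hpsi halpha hX r0 l2' fM.
pose kappa := l^-1 - 1.
have k0 : 0 <= kappa by rewrite subr_ge0 invf_ge1 // ltW.
pose mu k := M (t k) `^ (- r).
have mu0 k : 0 < mu k by rewrite powR_gt0// M0.
have mun k : mu k.+1 <= mu k.
  apply: powRN_le; [exact: ltW|exact: M0|].
  by apply: Mn => //; [rewrite tS ger_pMl ?ltW|have /andP[] := t01 k].
have k1 : 0 < 1 + kappa by apply: ltr_pwDl.
have cg0 : 0 < (1 + kappa) * (l^-1 * mu 0%N).
  by apply: mulr_gt0 => //; apply: mulr_gt0 => //; rewrite invr_gt0.
pose cG := ((1 + kappa) * (l^-1 * mu 0%N)) `^ p.
have cG0 : 0 < cG by exact: powR_gt0.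
pose C2 := (- ln l)^-1 `^ p * (2 `^ p / (p - 1)).
have C20 : 0 < C2.
  by rewrite mulr_gt0 ?divr_gt0 ?powR_gt0 ?subr_gt0// invr_gt0 oppr_gt0 ln_lt0.
pose C3 := (2 * l)^-1 * (C2 * (cG + kappa `^ p * C1)).
have C30 : 0 < C3.
  apply: mulr_gt0; first by rewrite invr_gt0 mulr_gt0.
  apply: mulr_gt0 => //; apply: ltr_pwDl => //.
  by apply: mulr_ge0; [exact: powR_ge0|exact: ltW].
pose C4 := 4 * C3 / (2 * l ^+ 2).
have C40 : 0 < C4.
  by apply: divr_gt0; apply: mulr_gt0 => //; exact: exprn_gt0.
exists (C4 `^ alpha^-1); split; first by rewrite powR_gt0.
move=> f [mf _].
pose F u := (osc f r u `^ r^-1 * ((psi u)^-1)%:E)%E.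
have mF : measurable_fun I01 F.
  apply: emeasurable_funM; last exact: measurable_inv_classA0.
  by apply: (measurableT_comp (measurable_poweR _)); exact: measurable_osc.
have A0 : (0 <= ri_norm X F)%E.
  by apply: (fnorm_ge0 (ri_function_norm X)); exact: Mplus_abse.
have B0 : (0 <= Lr_norm r f)%E by exact: poweR_ge0.
rewrite -/(ri_norm X F) -/F.
(* An infinite norm on the right-hand side leaves nothing to prove. *)
have [Afin|] := boolP (ri_norm X F \is a fin_num); last first.
  rewrite ge0_fin_numE// -leNgt leye_eq => /eqP ->.
  by rewrite addye ?gt0_muley ?leey ?lte_fin ?powR_gt0// -ltNye (lt_le_trans _ B0) ?ltNyr.
have [Bfin|] := boolP (Lr_norm r f \is a fin_num); last first.
  rewrite ge0_fin_numE// -leNgt leye_eq => /eqP ->.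
  by rewrite addey ?gt0_muley ?leey ?lte_fin ?powR_gt0// -ltNye (lt_le_trans _ A0) ?ltNyr.
pose A := fine (ri_norm X F); pose B := fine (Lr_norm r f).
have A0' : 0 <= A by exact: fine_ge0.
have B0' : 0 <= B by exact: fine_ge0.
pose k x := (`|f x| `^ r)%E.
have hG := integral_rearr_Lr_norm R r f r0 mf.
rewrite -(fineK Bfin) poweR_EFin -/B -/k in hG.
have kfin : (\int[leb]_(s in I01) rearr k s < +oo)%E.
  by apply: le_lt_trans hG _; exact: ltry.
pose b i := fine (maximal k (t i)).
pose o i := fine (osc f r (t i)).
have b0 i : 0 <= b i by apply: fine_ge0; exact: maximal_ge0.
have o0 i : 0 <= o i by exact: (osc_ge0 k kfin).
have ob : o 0%N <= b 0%N.
  rewrite /o /osc (fine_oscE k kfin)// gerBl; apply: fine_ge0; exact: rearr_ge0.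
have hb i : b i.+1 <= b i + kappa * o i.
  by rewrite /b tS; apply: (maximal_step k kfin); rewrite // l0 ltW.
(* t_0 = l, and ]0, l[ carries at most the whole integral of g*. *)
have bB : b 0%N <= l^-1 * B `^ r.
  rewrite -lee_fin EFinM /b fineK ?(maximal_fin_num k kfin)// /maximal /t expr1.
  rewrite lee_pmul2l ?lte_fin ?invr_gt0//; apply: le_trans hG.
  apply: ge0_subset_integral => //.
  - exact: measurable_itv.
  - by apply: measurable_rearr; exact: measurable_itv.
  - by move=> x _; exact: rearr_ge0.
  - by apply: subset_I01; rewrite l0 ltW.
pose Z := C3 * (A + B) `^ alpha.
have AB0 : 0 <= A + B by exact: addr_ge0.
have hbsum n : \sum_(i < n) w i * b i `^ p <=
    C2 * (cG + kappa `^ p * C1) * (A + B) `^ alpha.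
  apply: (@le_trans _ _ (\sum_(i < n) (- ln l)^-1 `^ p * (b i * mu i / i.+1%:R) `^ p)).
    by apply: ler_sum => i _; apply: (log_weight_invM r alpha l M).
  rewrite -mulr_sumr -mulrA /C2 -mulrA ler_wpM2l ?powR_ge0//.
  apply: le_trans (hardy_recursion p kappa b o mu n p1 k0 o0 ob b0
    (fun i => ltW (mu0 i)) mun hb) _.
  rewrite ler_wpM2l ?divr_ge0 ?powR_ge0 ?subr_ge0 ?(ltW p1)// [leRHS]mulrDl; apply: lerD.
    rewrite /cG -rp (powRrM (A + B)) -powRM ?powR_ge0 ?(ltW cg0)//.
    apply: ge0_ler_powR; rewrite ?nnegrE ?(ltW p0)//.
    - by apply: mulr_ge0; [exact: ltW|apply: mulr_ge0 => //; exact: ltW].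
    - by apply: mulr_ge0; [exact: ltW|exact: powR_ge0].
    have -> : (1 + kappa) * (l^-1 * mu 0%N) * (A + B) `^ r =
        (1 + kappa) * (l^-1 * (A + B) `^ r * mu 0%N) by ring.
    rewrite ler_wpM2l ?(ltW k1)// ler_wpM2r ?(ltW (mu0 _))//.
    apply: le_trans bB _; rewrite ler_wpM2l ?invr_ge0 ?(ltW l0)//.
    by apply: ge0_ler_powR; rewrite ?nnegrE ?(ltW r0)// lerDr.
  rewrite -mulrA ler_wpM2l ?powR_ge0//.
  apply: (@le_trans _ _ (C1 * A `^ alpha)).
    apply: le_trans (hC1 f kfin _ n); last by rewrite -ge0_fin_numE.
    apply: ler_sum => i _; rewrite le_eqVlt; apply/orP; left; apply/eqP.
    rewrite -/(t i) -/(o i) -rp [RHS]powRrM; congr (_ `^ _).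
    by rewrite powRM ?powR_ge0 ?invr_ge0 ?(ltW (M0 _ _))// -powRrM mulVf ?gt_eqF// powRr1//
       /mu -powR_inv1 ?(ltW (M0 _ _))// -powRrM mulN1r.
  rewrite ler_wpM2l ?(ltW C10)//; apply: ge0_ler_powR; rewrite ?nnegrE ?(ltW a0)//.
  by rewrite lerDl.
have frfin i : rearr f (t i) \is a fin_num.
  rewrite ge0_fin_numE ?rearr_ge0//.
  apply: (@lty_poweRy _ _ r); first by rewrite gt_eqF.
  apply: le_lt_trans (poweR_rearr_le f r (t i) r0) _.
  by rewrite -ge0_fin_numE ?rearr_ge0// (rearr_fin_num k kfin).
have hfb i : fine (rearr f (t i)) <= b i `^ r^-1.
  apply: le_root_powR => //; first by apply: fine_ge0; exact: rearr_ge0.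
  rewrite -lee_fin -poweR_EFin !fineK ?(maximal_fin_num k kfin)//.
  by apply: le_trans (poweR_rearr_le f r (t i) r0) (rearr_le_maximal k _ _).
have hZ n : \sum_(i < n) w i * fine (rearr f (t i.+1)) `^ alpha <= Z.
  (* f* at t_(i+1) is compared with g** there, so the index of w is shifted. *)
  apply: (@le_trans _ _ ((2 * l)^-1 * \sum_(i < n) w i.+1 * b i.+1 `^ p)).
    rewrite mulr_sumr; apply: ler_sum => i _; rewrite mulrA; apply: ler_pM => //.
    - exact: ltW.
    - exact: powR_ge0.
    - rewrite ler_pdivlMl; last exact: mulr_gt0.
      by rewrite -mulrA mulrC -ler_pdivlMr; [exact: hw|].
    - rewrite /p (mulrC alpha) powRrM.
      apply: ge0_ler_powR; rewrite ?nnegrE ?powR_ge0 ?(ltW a0)//.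
      by apply: fine_ge0; exact: rearr_ge0.
  rewrite /Z /C3 -mulrA; apply: ler_wpM2l.
    by rewrite invr_ge0 mulr_ge0// ltW.
  apply: le_trans (hbsum n.+1); rewrite big_ord_recl/= lerDr.
  by rewrite mulr_ge0 ?powR_ge0// ltW.
have hK := maximal_weighted_sum f l alpha Z w l01 halpha w0 hw frfin hZ.
have Dfin := maximal_finite f l alpha Z w l01 halpha w0 hw frfin hZ.
have := weighted_maximal_integral l alpha V l01 a0 V0 Vn Vl f (4 * Z) Dfin hK.
rewrite /H_norm => hI.
apply: (@le_trans _ _ ((4 * Z / (2 * l ^+ 2))%:E `^ alpha^-1)%E).
  apply: gt0_ler_poweR => //.
  - by rewrite invr_ge0 ltW.
  - rewrite in_itv/= leey andbT; apply: integral_ge0 => x.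
    rewrite /I01/= in_itv/= => /andP[x0 _].
    by rewrite mule_ge0 ?poweR_ge0// lee_fin invr_ge0 ltW.
  - rewrite in_itv/= leey andbT lee_fin.
    apply: divr_ge0; apply: mulr_ge0.
    + by [].
    + by apply: mulr_ge0; [exact: ltW|exact: powR_ge0].
    + by [].
    + by apply: exprn_ge0; exact: ltW.
rewrite -(fineK Afin) -(fineK Bfin) -EFinD -EFinM poweR_EFin lee_fin -/A -/B.
have -> : 4 * Z / (2 * l ^+ 2) = C4 * (A + B) `^ alpha.
  by rewrite /C4 /Z; field; rewrite gt_eqF.
rewrite powRM ?powR_ge0 ?(ltW C40)// -powRrM mulfV ?gt_eqF// powRr1//.
Qed.
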